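(* Let $\tau>0$, $M\ge0$, $\ell\ge1$, and let a quadrature rule on $\widehat{\mathbb K}$ with distinct points $\widehat{\boldsymbol\xi}_i\in\widehat{\mathbb K}$ and positive weights $\widehat\omega_i>0$, $i=1,\dots,Q$, be given which is exact to degree $3\ell-2$. Let discrete closed surfaces $\Gamma_h^m=\boldsymbol Y_h^m(\widehat\Gamma_h)$ of degree $\ell$ be generated from a given $\boldsymbol Y_h^0$ as follows: for each $m=0,\dots,M$, the surface $\Gamma_h^m$ satisfies ($\mathcal B1^h$): $|\mathcal J(\boldsymbol Y_h^m|_{\widehat\sigma_j})|(A_j(\widehat{\boldsymbol\xi}_i))>0$ for all $j=1,\dots,J$, $i=1,\dots,Q$; the pair $(\boldsymbol X_h^{m+1},H_h^{m+1})\in[\mathbb W_\ell^m]^3\times\mathbb W_\ell^m$ is a solution of the nonlinear system $$\Big(\frac{\boldsymbol X_h^{m+1}-\mathrm{id}}{\tau},\varphi_h\boldsymbol n_h^{m+\frac12}\Big)^h_{\Gamma_h^m}-(\nabla_{\Gamma_h^m}H_h^{m+1},\nabla_{\Gamma_h^m}\varphi_h)^h_{\Gamma_h^m}=0,$$ $$(H_h^{m+1}\boldsymbol n_h^{m+\frac12},\boldsymbol\eta_h)^h_{\Gamma_h^m}+(\nabla_{\Gamma_h^m}\boldsymbol X_h^{m+1},\nabla_{\Gamma_h^m}\boldsymbol\eta_h)^h_{\Gamma_h^m}=0$$ for all $\varphi_h\in\mathbb W_\ell^m$, $\boldsymbol\eta_h\in[\mathbb W_\ell^m]^3$, where $\boldsymbol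 Y_h^{m+1}=\boldsymbol X_h^{m+1}\circ\boldsymbol Y_h^m$, $\boldsymbol Y_h^{m+1/2}=\frac12(\boldsymbol Y_h^m+\boldsymbol Y_h^{m+1})$ and, piecewise on each $\widehat\sigma_j$, $$\boldsymbol n_h^{m+\frac12}\circ\boldsymbol Y_h^m=\frac{\mathcal J(\boldsymbol Y_h^m)+4\mathcal J(\boldsymbol Y_h^{m+1/2})+\mathcal J(\boldsymbol Y_h^{m+1})}{6|\mathcal J(\boldsymbol Y_h^m)|}.$$ Then $$S_h^{M+1}+\tau\sum_{m=0}^M(\nabla_{\Gamma_h^m}H_h^{m+1},\nabla_{\Gamma_h^m}H_h^{m+1})^h_{\Gamma_h^m}\le S_h^0,\qquad V_h^{M+1}=V_h^M=\cdots=V_h^1=V_h^0,$$ where $S_h^m=(1,1)^h_{\Gamma_h^m}$ is the numerical surface area and $V_h^m=\frac13\int_{\Gamma_h^m}\mathrm{id}\cdot\boldsymbol n_h^m\,\mathrm ds=\frac13\int_{\widehat\Gamma_h}\boldsymbol Y_h^m\cdot\mathcal J(\boldsymbol Y_h^m)\,\mathrm ds$ is the volume enclosed by $\Gamma_h^m$.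
   Context: Reference grid. $\widehat{\mathbb K}\subset\mathbb R^2$ is the standard 2-simplex; $\widehat\Gamma_h=\bigcup_{j=1}^J\widehat\sigma_j\subset\mathbb R^3$ is a closed oriented polyhedral surface, conformingly triangulated by flat triangles $\widehat\sigma_j=A_j(\widehat{\mathbb K})$, $A_j$ injective affine maps. On $\widehat\sigma_j$, $\{\widehat{\boldsymbol\tau}_1,\widehat{\boldsymbol\tau}_2\}$ is an orthonormal basis of the tangent space, compatible with the orientation. $\mathbb P^\ell$ denotes polynomials of degree $\le\ell$. Discrete surface. $\boldsymbol Y_h^m:\widehat\Gamma_h\to\mathbb R^3$ is continuous with $\boldsymbol Y_h^m|_{\widehat\sigma_j}\in[\mathbb P^\ell(\widehat\sigma_j)]^3$; $\boldsymbol F_{h,j}^m=\boldsymbol Y_h^m|_{\widehat\sigma_j}\circ A_j$; $\Gamma_h^m=\boldsymbol Y_h^m(\widehat\Gamma_h)$. Functions on $\Gamma_h^m$ are identified with their pull-backs under $\boldsymbol Y_h^m$ to $\widehat\Gamma_h$. The finite element space is $$\mathbb W_\ell^m=\{v_h\in H^1(\Gamma_h^m): v_h\circ\boldsymbol Y_h^m|_{\widehat\sigma_j}\in\mathbb P^\ell(\widehat\sigma_j),\ j=1,\dots,J\},$$ i.e. the functions whose pull-back is continuous on $\widehat\Gamma_h$ and polynomial of degree $\le\ell$ on each triangle. $\mathrm{id}$ is the identity on $\Gamma_h^m$ (pull-back $\boldsymbol Y_h^m$). Geometry (piecewise). For a piecewise $C^1$ map $\boldsymbol Y:\widehat\Gamma_h\to\mathbb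 R^3$, $\mathcal J(\boldsymbol Y)=\partial_{\widehat{\boldsymbol\tau}_1}\boldsymbol Y\times\partial_{\widehat{\boldsymbol\tau}_2}\boldsymbol Y$ on $\widehat\sigma_j$; $\mathcal J(\boldsymbol F_{h,j}^m)=\partial_{\boldsymbol e_1}\boldsymbol F_{h,j}^m\times\partial_{\boldsymbol e_2}\boldsymbol F_{h,j}^m$ with $\boldsymbol e_1,\boldsymbol e_2$ the unit vectors of $\mathbb R^2$. Wherever $|\mathcal J(\boldsymbol Y_h^m)|>0$, $\boldsymbol n_h^m\circ\boldsymbol Y_h^m=\mathcal J(\boldsymbol Y_h^m)/|\mathcal J(\boldsymbol Y_h^m)|$ (orientations chosen so that it is the outer unit normal), and $\nabla_{\Gamma_h^m}$ is the piecewise surface gradient on $\Gamma_h^m$: $\nabla_{\Gamma_h^m}f=\sum_{k=1}^2(\partial_{\boldsymbol\tau_k}f)\,\boldsymbol\tau_k$ (for vector-valued $f$: $\sum_k\partial_{\boldsymbol\tau_k}f\otimes\boldsymbol\tau_k$), with $\{\boldsymbol\tau_1,\boldsymbol\tau_2\}$ an orthonormal basis of the tangent space of the curved element, i.e. of the range of the derivative of $\boldsymbol Y_h^m|_{\widehat\sigma_j}$. Quadrature. $\int^h_{\widehat{\mathbb K}}f\,\mathrm d\widehat{\boldsymbol x}=\sum_{i=1}^Qf(\widehat{\boldsymbol\xi}_i)\widehat\omega_i$; the rule is exact to degree $p$ if this equals $\int_{\widehat{\mathbb K}}f\,\mathrm d\widehat{\boldsymbol x}$ for all $f\in\mathbb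 P^p(\widehat{\mathbb K})$. Moreover $$(u,v)^h_{\Gamma_h^m}=\sum_{j=1}^J\sum_{i=1}^Q(u\circ\boldsymbol F_{h,j}^m)(\widehat{\boldsymbol\xi}_i)\cdot(v\circ\boldsymbol F_{h,j}^m)(\widehat{\boldsymbol\xi}_i)\,|\mathcal J(\boldsymbol F_{h,j}^m)|(\widehat{\boldsymbol\xi}_i)\,\widehat\omega_i$$ (product, Euclidean or Frobenius inner product for scalars, vectors, matrices; piecewise-defined quantities are evaluated from within element $j$). *)

(* Defs.v *)
From HB Require Import structures.
From mathcomp Require Import all_boot all_order all_algebra.
From mathcomp Require Import all_classical all_reals all_analysis.

Set Implicit Arguments.
Unset Strict Implicit.
Unset Printing Implicit Defensive.

Import Order.TTheory GRing.Theory Num.Theory.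
Import numFieldNormedType.Exports.

Local Open Scope classical_set_scope.
Local Open Scope ring_scope.

(** * Euclidean structure *)

(* Euclidean inner product of vectors, Frobenius inner product of matrices. *)
Definition mxdot {R : realType} {m n : nat} (A B : 'M[R]_(m, n)) : R :=
  \sum_(i < m) \sum_(k < n) A i k * B i k.

(* Not the library norm `|A|, which is the maximum norm. *)
Definition enorm {R : realType} {m n : nat} (A : 'M[R]_(m, n)) : R :=
  Num.sqrt (mxdot A A).

(* The indices k + 1 and k + 2 are taken modulo 3. *)
Definition cross {R : realType} (u v : 'rV[R]_3) : 'rV[R]_3 :=
  \row_k (u 0 (k + 1) * v 0 (k + 2) - u 0 (k + 2) * v 0 (k + 1)).

(* The derivative of f in the direction v at a point z of the closure of S,
   taken from within S: the limit at z of the directional derivatives at points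
   of S.  It is used with S a relatively open element and v tangent to S; it
   then only involves the values of f on S, also when z lies on the boundary. *)
Definition dwithin {R : realType} {U V : normedModType R} (S : set U) (v : U)
    (f : U -> V) (z : U) : V :=
  lim ('D_v f y @[y --> within S (nbhs z)]).

(** * The reference triangle *)

Definition refT {R : realType} : set (R * R) :=
  [set x | [/\ 0 <= x.1, 0 <= x.2 & x.1 + x.2 <= 1]].

Definition refT_open {R : realType} : set (R * R) :=
  [set x | [/\ 0 < x.1, 0 < x.2 & x.1 + x.2 < 1]].

Definition int_refT {R : realType} (f : R * R -> R) : R :=
  \int[(lebesgue_measure \x lebesgue_measure)%E]_(x in refT) f x.

(* Restrictions to the reference triangle of polynomials of degree <= d. *)
Definition poly_refT {R : realType} (d : nat) (f : R * R -> R) : Prop :=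
  exists c : nat -> nat -> R, forall x, refT x ->
    f x = \sum_(a < d.+1) \sum_(b < d.+1 | (a + b <= d)%N)
            c a b * x.1 ^+ a * x.2 ^+ b.

Definition exact_to_degree {R : realType} (p Q : nat) (xi : 'I_Q -> R * R)
    (omega : 'I_Q -> R) : Prop :=
  forall f : R * R -> R, poly_refT p f ->
    \sum_(i < Q) f (xi i) * omega i = int_refT f.

(** * The polyhedral reference surface *)

Definition affmap {R : realType} (P : 'I_3 -> 'rV[R]_3) (x : R * R) :
    'rV[R]_3 :=
  P 0 + x.1 *: (P 1 - P 0) + x.2 *: (P 2 - P 0).

(* The face of the triangle with vertices P spanned by the vertices in S (empty
   if S is empty, the triangle itself if S is full). *)
Definition face {R : realType} (P : 'I_3 -> 'rV[R]_3) (S : {set 'I_3}) :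
    set 'rV[R]_3 :=
  [set z | exists lam : 'I_3 -> R,
    [/\ forall a, 0 <= lam a, forall a, a \notin S -> lam a = 0,
        \sum_a lam a = 1 & z = \sum_a lam a *: P a]].

Definition tangent_to {R : realType} (P : 'I_3 -> 'rV[R]_3) (v : 'rV[R]_3) :
    Prop :=
  exists a b : R, v = a *: (P 1 - P 0) + b *: (P 2 - P 0).

(* The directed edge from p to q of the triangle with vertices P is positively
   traversed with respect to the normal nu. *)
Definition positive_edge {R : realType} (P : 'I_3 -> 'rV[R]_3)
    (nu p q : 'rV[R]_3) : Prop :=
  exists a b c : 'I_3,
    [/\ p = P a, q = P b & 0 < mxdot (cross (q - p) (P c - p)) nu].

(* Two triangles that contain the vertex p and share another vertex. *)
Definition adjacent_at {R : realType} {n : nat} (P : 'I_n -> 'I_3 -> 'rV[R]_3)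
    (p : 'rV[R]_3) : rel 'I_n :=
  fun j k => [&& p \in codom (P j), p \in codom (P k) &
    [exists a, (P j a != p) && (P j a \in codom (P k))]].

(* A nonempty closed oriented polyhedral surface, conformingly triangulated by
   the triangles with vertices vtx j; frame j is an orthonormal basis of the
   tangent space of triangle j compatible with the orientation.  The vertices
   of a triangle need not be numbered compatibly with the orientation, which is
   given by the unit normals cross (frame j 0) (frame j 1). *)
Record ref_surface (R : realType) := RefSurface {
  ntri : nat;
  vtx : 'I_ntri -> 'I_3 -> 'rV[R]_3;
  frame : 'I_ntri -> 'I_2 -> 'rV[R]_3;
  ntri_gt0 : (0 < ntri)%N;
  affmap_inj : forall j, injective (affmap (vtx j));
  (* two distinct triangles intersect in a common proper face (empty, a vertex
     or an edge) *)
  conforming : forall j k, j != k ->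
    exists S T : {set 'I_3},
      [/\ S != [set: 'I_3]%SET, T != [set: 'I_3]%SET,
          affmap (vtx j) @` refT `&` affmap (vtx k) @` refT = face (vtx j) S &
          face (vtx j) S = face (vtx k) T];
  (* each edge belongs to exactly two triangles *)
  closed_edges : forall j a b, a != b ->
    #|[set k | (vtx j a \in codom (vtx k)) &&
               (vtx j b \in codom (vtx k))]%SET| = 2%N;
  (* the triangles around a vertex form a single cycle, so that the surface is
     a manifold also at the vertices *)
  connected_stars : forall p j k,
    p \in codom (vtx j) -> p \in codom (vtx k) ->
    connect (adjacent_at vtx p) j k;
  frame_tangent : forall j a, tangent_to (vtx j) (frame j a);
  frame_orthonormal : forall j a b,
    mxdot (frame j a) (frame j b) = (a == b)%:R;
  (* neighbouring triangles traverse their common edge in opposite directions *)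
  coherent : forall j k p q, j != k ->
    positive_edge (vtx j) (cross (frame j 0) (frame j 1)) p q ->
    ~ positive_edge (vtx k) (cross (frame k 0) (frame k 1)) p q
}.

Definition chart {R : realType} (G : ref_surface R) (j : 'I_(ntri G)) :
    R * R -> 'rV[R]_3 :=
  affmap (vtx j).

Definition carrier {R : realType} (G : ref_surface R) : set 'rV[R]_3 :=
  [set z | exists j : 'I_(ntri G), (chart j @` refT) z].

(** * Finite element functions *)

(* Functions on the discrete surface Y(carrier G) are represented by their
   pull-backs to carrier G, extended arbitrarily to R^3; only their values on
   carrier G matter.  In particular the identity on the discrete surface is
   represented by Y itself, and the finite element space on the discrete
   surface by the space below, which does not depend on Y. *)
Definition fe_space {R : realType} (G : ref_surface R) (ell : nat)
    (v : 'rV[R]_3 -> R) : Prop :=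
  {within carrier G, continuous v} /\
  forall j : 'I_(ntri G), poly_refT ell (v \o chart j).

Definition fe_space3 {R : realType} (G : ref_surface R) (ell : nat)
    (X : 'rV[R]_3 -> 'rV[R]_3) : Prop :=
  forall k : 'I_3, fe_space G ell (fun z => X z 0 k).

(** * Piecewise geometry *)

(* Derivative on triangle j in the tangential direction v. *)
Definition dtan {R : realType} (G : ref_surface R) (j : 'I_(ntri G))
    {V : normedModType R} (v : 'rV[R]_3) (f : 'rV[R]_3 -> V) :
    'rV[R]_3 -> V :=
  dwithin (chart j @` refT_open) v f.

Definition jac {R : realType} (G : ref_surface R) (Y : 'rV[R]_3 -> 'rV[R]_3)
    (j : 'I_(ntri G)) (z : 'rV[R]_3) : 'rV[R]_3 :=
  cross (dtan j (frame j 0) Y z) (dtan j (frame j 1) Y z).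

Definition jac_param {R : realType} (F : R * R -> 'rV[R]_3) (x : R * R) :
    'rV[R]_3 :=
  cross (dwithin refT_open ((1, 0) : R * R) F x)
        (dwithin refT_open ((0, 1) : R * R) F x).

Definition normal {R : realType} (G : ref_surface R)
    (Y : 'rV[R]_3 -> 'rV[R]_3) (j : 'I_(ntri G)) (z : 'rV[R]_3) : 'rV[R]_3 :=
  (enorm (jac Y j z))^-1 *: jac Y j z.

Definition midpoint_map {R : realType} (Y Z : 'rV[R]_3 -> 'rV[R]_3)
    (z : 'rV[R]_3) : 'rV[R]_3 :=
  2^-1 *: (Y z + Z z).

(* The averaged normal n^{m+1/2}, with Y = Y^m and Z = Y^{m+1}. *)
Definition half_normal {R : realType} (G : ref_surface R)
    (Y Z : 'rV[R]_3 -> 'rV[R]_3) (j : 'I_(ntri G)) (z : 'rV[R]_3) :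
    'rV[R]_3 :=
  (6 * enorm (jac Y j z))^-1 *:
    (jac Y j z + 4 *: jac (midpoint_map Y Z) j z + jac Z j z).

(* Vectors v_1, v_2 tangent to triangle j whose images tau_k = dY(v_k) form an
   orthonormal basis of the range of the derivative of Y at z.  An arbitrary
   choice of such a pair; it exists where jac Y j z <> 0. *)
Definition surf_frame {R : realType} (G : ref_surface R)
    (Y : 'rV[R]_3 -> 'rV[R]_3) (j : 'I_(ntri G)) (z : 'rV[R]_3) :
    'rV[R]_3 * 'rV[R]_3 :=
  xget (0, 0) [set v : 'rV[R]_3 * 'rV[R]_3 |
    [/\ tangent_to (vtx j) v.1 /\ tangent_to (vtx j) v.2,
        mxdot (dtan j v.1 Y z) (dtan j v.1 Y z) = 1,
        mxdot (dtan j v.2 Y z) (dtan j v.2 Y z) = 1 &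
        mxdot (dtan j v.1 Y z) (dtan j v.2 Y z) = 0]].

(* Surface gradient on Y(carrier G) of a scalar function with pull-back f: by
   the chain rule, the derivative along tau_k = dY(v_k) pulls back to the
   derivative of f along v_k. *)
Definition surf_grad {R : realType} (G : ref_surface R)
    (Y : 'rV[R]_3 -> 'rV[R]_3) (f : 'rV[R]_3 -> R) (j : 'I_(ntri G))
    (z : 'rV[R]_3) : 'rV[R]_3 :=
  let v := surf_frame Y j z in
  dtan j v.1 f z *: dtan j v.1 Y z + dtan j v.2 f z *: dtan j v.2 Y z.

(* The same for a vector-valued function; u^T *m t is the tensor product of the
   row vectors u and t. *)
Definition surf_grad3 {R : realType} (G : ref_surface R)
    (Y X : 'rV[R]_3 -> 'rV[R]_3) (j : 'I_(ntri G)) (z : 'rV[R]_3) :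
    'M[R]_(3, 3) :=
  let v := surf_frame Y j z in
  (dtan j v.1 X z)^T *m dtan j v.1 Y z + (dtan j v.2 X z)^T *m dtan j v.2 Y z.

(** * Discrete inner products, area and volume *)

(* The quadrature inner product on Y(carrier G) of piecewise-defined functions
   u, v (given on each triangle j by the pull-backs u j, v j), where ip is the
   inner product of their values. *)
Definition quad_prod {R : realType} (G : ref_surface R) (Q : nat)
    (xi : 'I_Q -> R * R) (omega : 'I_Q -> R) {T : Type} (ip : T -> T -> R)
    (Y : 'rV[R]_3 -> 'rV[R]_3) (u v : 'I_(ntri G) -> 'rV[R]_3 -> T) : R :=
  \sum_(j < ntri G) \sum_(i < Q)
    ip (u j (chart j (xi i))) (v j (chart j (xi i))) *
    enorm (jac_param (Y \o chart j) (xi i)) * omega i.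

Definition num_area {R : realType} (G : ref_surface R) (Q : nat)
    (xi : 'I_Q -> R * R) (omega : 'I_Q -> R) (Y : 'rV[R]_3 -> 'rV[R]_3) : R :=
  @quad_prod R G Q xi omega R *%R Y (fun _ _ => 1) (fun _ _ => 1).

(* Surface integral over the polyhedral surface: sum over the flat triangles,
   in the affine parametrization. *)
Definition surf_int {R : realType} (G : ref_surface R)
    (g : 'I_(ntri G) -> 'rV[R]_3 -> R) : R :=
  \sum_(j < ntri G)
    int_refT (fun x => g j (chart j x) *
                enorm (cross (vtx j 1 - vtx j 0) (vtx j 2 - vtx j 0))).

Definition volume {R : realType} (G : ref_surface R)
    (Y : 'rV[R]_3 -> 'rV[R]_3) : R :=
  3^-1 * @surf_int R G (fun j z => mxdot (Y z) (jac Y j z)).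

Lemma mxdotZr {R : realType} m n (c : R) (A B : 'M[R]_(m, n)) :
  mxdot A (c *: B) = c * mxdot A B.
Proof.
rewrite /mxdot mulr_sumr; apply: eq_bigr => i _; rewrite mulr_sumr.
by apply: eq_bigr => k _; rewrite mxE mulrCA.
Qed.

Lemma enorm_eq0 {R : realType} m n (A : 'M[R]_(m, n)) : enorm A = 0 -> A = 0.
Proof.
have h0 i : 0 <= \sum_(k < n) A i k * A i k.
  by apply: sumr_ge0 => k _; rewrite -expr2 sqr_ge0.
move=> /eqP; rewrite /enorm sqrtr_eq0 => A0.
have /eqP : mxdot A A = 0 by apply/eqP; rewrite eq_le A0 /= sumr_ge0.
rewrite psumr_eq0 // => /allP Ai; apply/matrixP => i k; rewrite mxE.
have := Ai i (mem_index_enum _); rewrite /= psumr_eq0; last first.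
  by move=> l _; rewrite -expr2 sqr_ge0.
by move=> /allP/(_ k (mem_index_enum _)); rewrite /= mulf_eq0 orbb => /eqP.
Qed.

(* [volume] is also one third of the integral over Y(carrier G) of id . n,
   whose area element pulls back to enorm (jac Y) times that of carrier G. *)
Lemma volumeE {R : realType} (G : ref_surface R) (Y : 'rV[R]_3 -> 'rV[R]_3) :
  volume G Y = 3^-1 * @surf_int R G
    (fun j z => mxdot (Y z) (normal Y j z) * enorm (jac Y j z)).
Proof.
congr (_ * surf_int _); apply/funext => j; apply/funext => z.
rewrite /normal mxdotZr.
have [/enorm_eq0 J0|J0] := eqVneq (enorm (jac Y j z)) 0.
  suff -> : mxdot (Y z) (jac Y j z) = 0 by rewrite mulr0 mul0r.
  by rewrite J0 -(scale0r (jac Y j z)) mxdotZr mul0r.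
by rewrite mulrAC mulVf ?mul1r.
Qed.

(** * The discrete equations *)

(* One step of the scheme, with Y = Y^m, Z = Y^{m+1} (the pull-back of X^{m+1})
   and H = H^{m+1}. *)
Definition scheme_step {R : realType} (G : ref_surface R) (ell Q : nat)
    (xi : 'I_Q -> R * R) (omega : 'I_Q -> R) (tau : R)
    (Y Z : 'rV[R]_3 -> 'rV[R]_3) (H : 'rV[R]_3 -> R) : Prop :=
  [/\ fe_space3 G ell Z,
      fe_space G ell H,
      forall phi, fe_space G ell phi ->
        @quad_prod R G Q xi omega _ mxdot Y
          (fun _ z => tau^-1 *: (Z z - Y z))
          (fun j z => phi z *: half_normal Y Z j z)
        - @quad_prod R G Q xi omega _ mxdot Y
            (surf_grad Y H) (surf_grad Y phi) = 0 &
      forall eta, fe_space3 G ell eta ->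
        @quad_prod R G Q xi omega _ mxdot Y
          (fun j z => H z *: half_normal Y Z j z)
          (fun _ z => eta z)
        + @quad_prod R G Q xi omega _ mxdot Y
            (surf_grad3 Y Z) (surf_grad3 Y eta) = 0].

(* Main.v *)
Require Import Defs.
From HB Require Import structures.
From mathcomp Require Import all_boot all_order all_algebra.
From mathcomp Require Import all_classical all_reals all_analysis.
From mathcomp Require Import unstable measurable_realfun ring lra zify.
Set Implicit Arguments.
Unset Strict Implicit.
Unset Printing Implicit Defensive.
Import Order.TTheory GRing.Theory Num.Theory.
Import numFieldNormedType.Exports.
Local Open Scope classical_set_scope.
Local Open Scope ring_scope.

(** The area decay and the volume conservation each follow from one choice of
    test functions in a step from Y = Y^m to Z = Y^{m+1}.

    Area.  With phi = H and eta = (Z - Y)/tau the terms containing the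
    averaged normal agree, which leaves tau |grad H|^2 + grad Z : grad (Z - Y)
    = 0 in the quadrature inner product ([energy_step]).  At a node where dY
    has rank two, let t_1, t_2 be an orthonormal frame in the range of dY and
    z_1, z_2 the vectors that dZ assigns to the same parameter vectors.  Then
      grad Z : grad (Z - Y) = sum_k z_k . (z_k - t_k)
        >= (|z_1|^2 + |z_2|^2)/2 - 1 >= |z_1 x z_2| - |t_1 x t_2|,
    so the second term dominates the increment of the area element node by
    node ([area_increment]), and the weights are positive.

    Volume.  With phi = 1 the quadrature of (Z - Y) . (J(Y) + 4 J(M) + J(Z))/6
    vanishes, where M is the midpoint of Y and Z.  On each triangle the
    integrand is a polynomial of degree ell + 2 (ell - 1) = 3 ell - 2, so the
    rule is exact and the surface integral itself vanishes.  This integral is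
    the change of volume: the form f, g, h -> integral of f dg /\ dh
    ([triform]) on single-valued piecewise polynomial functions is trilinear,
    obviously antisymmetric in g and h, and antisymmetric in f and g because f
    dg /\ dh + g df /\ dh = d(fg dh) is exact. The latter uses Green's formula
    on each triangle ([green_refT]) and the fact that on a closed oriented
    surface the line integrals over the edges cancel in pairs
    ([closed_surface_sum]).  The volume is this alternating form evaluated at
    the three coordinates ([volume_triform]); along the segment from Y to Z it
    is a cubic polynomial, and Simpson's rule for its quadratic derivative is
    exactly the averaged Jacobian ([simpson_alternating]).

    All derivatives are computed in the affine charts.  There a finite element
    function is a polynomial, and the one-sided derivatives of the geometry
    are its directional derivatives, also on the boundary of the triangle
    ([dtan_represents3]).  The Jacobians with respect to the frame and to the
    chart differ by the factor orient/area ([jac_represents3]), whose sign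
    brings in the orientation of the surface. *)

(** * Polynomial functions on the parameter plane *)

(** Global polynomial functions, as opposed to [poly_refT], which constrains a
    function on the reference triangle only: derivatives can then be taken at
    every point, those of the boundary of the triangle included.  Sums of
    monomials are generated freely, so that identities and closure properties
    follow by induction from the case of a monomial. *)
Inductive polyfun {R : realType} (d : nat) : (R * R -> R) -> Prop :=
| polyfun_monom (c : R) (a b : nat) : (a + b <= d)%N ->
    polyfun d (fun x => c * x.1 ^+ a * x.2 ^+ b)
| polyfunD (f g : R * R -> R) : polyfun d f -> polyfun d g ->
    polyfun d (fun x => f x + g x).

(** Both partial derivatives are sealed: comparing two of them up to
    conversion would unfold limits. *)
HB.lock Definition dx {R : realType} (f : R * R -> R) : R * R -> R :=
  'D_((1, 0) : R * R) f.
HB.lock Definition dy {R : realType} (f : R * R -> R) : R * R -> R :=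
  'D_((0, 1) : R * R) f.

Section polyfun_theory.
Context {R : realType}.
Implicit Types (f g : R * R -> R) (d e : nat).

Lemma polyfun_ext d f g : f =1 g -> polyfun d g -> polyfun d f.
Proof. by move=> /funext ->. Qed.

Lemma polyfun_cst d (c : R) : polyfun d (fun=> c).
Proof.
apply: (@polyfun_ext _ _ (fun x => c * x.1 ^+ 0 * x.2 ^+ 0)).
  by move=> x; rewrite !expr0 !mulr1.
exact: polyfun_monom.
Qed.

Lemma polyfunW d e f : (d <= e)%N -> polyfun d f -> polyfun e f.
Proof.
move=> de; elim=> [c a b ab|*]; last exact: polyfunD.
by apply: polyfun_monom; exact: leq_trans de.
Qed.

Lemma polyfunM d e f g : polyfun d f -> polyfun e g ->
  polyfun (d + e)%N (fun x => f x * g x).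
Proof.
move=> pf pg; elim: pf => [c a b ab|f1 f2 _ p1 _ p2]; last first.
  by apply: polyfun_ext (polyfunD p1 p2) => x; rewrite mulrDl.
elim: pg => [c' a' b' ab'|f1 f2 _ p1 _ p2]; last first.
  by apply: polyfun_ext (polyfunD p1 p2) => x; rewrite mulrDr.
apply: (@polyfun_ext _ _ (fun x => c * c' * x.1 ^+ (a + a') * x.2 ^+ (b + b'))).
  by move=> x; rewrite !exprD; ring.
by apply: polyfun_monom; lia.
Qed.

Lemma polyfunZ d (c : R) f : polyfun d f -> polyfun d (fun x => c * f x).
Proof. exact: (@polyfunM 0 d) (polyfun_cst 0 c). Qed.

Lemma polyfunB d f g : polyfun d f -> polyfun d g ->
  polyfun d (fun x => f x - g x).
Proof.
move=> pf pg; apply: (polyfun_ext _ (polyfunD pf (polyfunZ (-1) pg))) => x.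
by rewrite mulN1r.
Qed.

Lemma polyfun_comb d (a b : R) f g : polyfun d f -> polyfun d g ->
  polyfun d (fun x => a * f x + b * g x).
Proof. by move=> pf pg; apply: polyfunD; exact: polyfunZ. Qed.

Lemma polyfun_sum d (I : Type) (r : seq I) (P : pred I) (F : I -> R * R -> R) :
  (forall i, P i -> polyfun d (F i)) ->
  polyfun d (fun x => \sum_(i <- r | P i) F i x).
Proof.
move=> pF; elim: r => [|i r IH].
  by apply: (polyfun_ext _ (polyfun_cst d 0)) => x; rewrite big_nil.
case Pi : (P i).
  by apply: (polyfun_ext _ (polyfunD (pF i Pi) IH)) => x; rewrite big_cons Pi.
by apply: (polyfun_ext _ IH) => x; rewrite big_cons Pi.
Qed.

Lemma polyfun_poly_refT d f : polyfun d f -> poly_refT d f.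
Proof.
elim=> [c a b ab|f1 f2 _ [c1 E1] _ [c2 E2]]; last first.
  exists (fun a b => c1 a b + c2 a b) => x Tx; rewrite E1// E2// -big_split/=.
  apply: eq_bigr => a _; rewrite -big_split/=; apply: eq_bigr => b _.
  by rewrite !mulrDl.
have ad : (a < d.+1)%N by lia.
have bd : (b < d.+1)%N by lia.
exists (fun a' b' => c *+ ((a' == a) && (b' == b))) => x Tx.
rewrite (bigD1 (Ordinal ad))//= (bigD1 (Ordinal bd))//= !eqxx/=.
rewrite big1 ?addr0; last first.
  move=> i /andP[_]; rewrite -val_eqE/= => /negPf ->.
  by rewrite mulr0n !mul0r.
rewrite big1 ?addr0// => i.
rewrite -val_eqE/= => /negPf ->; rewrite big1// => k _.
by rewrite mulr0n !mul0r.
Qed.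

(** The global function is given by the same coefficients. *)
Lemma poly_refT_polyfun d (f : R * R -> R) : poly_refT d f ->
  exists2 g, polyfun d g & forall x, refT x -> f x = g x.
Proof.
case=> c E; eexists; last exact: E.
apply: polyfun_sum => a _; apply: polyfun_sum => b ab.
exact: polyfun_monom.
Qed.

Lemma is_derive_affine (f : R * R -> R) (x w : R * R) (l : R) :
  (forall h : R, f (h *: w + x) = h * l + f x) -> is_derive x w f l.
Proof.
move=> fE.
have cl : h^-1 *: ((f \o shift x) (h *: w) - f x) @[h --> (0:R)^'] --> l.
  apply: cvg_near_cst; near=> h.
  have h0 : h != 0 by near: h; exact: nbhs_dnbhs_neq.
  by rewrite /= fE addrK /GRing.scale/= mulKf.
apply: DeriveDef; first by apply/cvg_ex; exists l.
exact: cvg_lim cl.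
Unshelve. all: by end_near. Qed.

Lemma is_derive_val f x w (l : R) : is_derive x w f l -> 'D_w f x = l.
Proof. by case. Qed.

Lemma is_derive_monom (c : R) (a b : nat) (x w : R * R) :
  is_derive x w (fun x => c * x.1 ^+ a * x.2 ^+ b)
    (w.1 * (c * a%:R * x.1 ^+ a.-1 * x.2 ^+ b) +
     w.2 * (c * b%:R * x.1 ^+ a * x.2 ^+ b.-1)).
Proof.
have d1 : is_derive x w (fst : R * R -> R) w.1 by exact: is_derive_affine.
have d2 : is_derive x w (snd : R * R -> R) w.2 by exact: is_derive_affine.
have -> : (fun x : R * R => c * x.1 ^+ a * x.2 ^+ b) =
    c \*: ((fst : R * R -> R) ^+ a * (snd : R * R -> R) ^+ b).
  apply/funext => y; rewrite /GRing.scale/= -mulrA; congr (_ * _).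
  by rewrite !fctE.
apply: is_derive_eq; rewrite !fctE /GRing.scale/=; ring.
Qed.

(** Existence of the partial derivatives and linearity of the derivative in
    the direction, in one statement, because all later rules are read off from
    it. The degree drops by one; for constants the predecessor of 0 is 0, and
    the monomial then has coefficient 0. *)
Lemma polyfun_is_derive d f : polyfun d f ->
  exists fx fy, [/\ polyfun d.-1 fx, polyfun d.-1 fy &
    forall x w, is_derive x w f (w.1 * fx x + w.2 * fy x)].
Proof.
elim=> [c a b ab|f1 f2 p1 [fx [fy [pfx pfy E]]] p2 [gx [gy [pgx pgy E']]]];
    last first.
  exists (fun x => fx x + gx x), (fun x => fy x + gy x).
  split; [exact: polyfunD|exact: polyfunD|] => x w.
  apply: (is_derive_eq (is_deriveD (E x w) (E' x w))); ring.
exists (fun x => (c * a%:R) * x.1 ^+ a.-1 * x.2 ^+ b).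
exists (fun x => (c * b%:R) * x.1 ^+ a * x.2 ^+ b.-1).
split; last by move=> x w; exact: is_derive_monom.
- case: a ab => [|a] ab; last by apply: polyfun_monom => /=; lia.
  apply: (polyfun_ext _ (polyfun_cst _ 0)) => x.
  by rewrite mulr0 !mul0r.
- case: b ab => [|b] ab; last by apply: polyfun_monom => /=; lia.
  apply: (polyfun_ext _ (polyfun_cst _ 0)) => x.
  by rewrite mulr0 !mul0r.
Qed.

Lemma polyfun_dE f fx fy :
  (forall x w, is_derive x w f (w.1 * fx x + w.2 * fy x)) ->
  dx f = fx /\ dy f = fy.
Proof.
move=> E; split; apply/funext => x; rewrite ?dx.unlock ?dy.unlock.
- by rewrite (is_derive_val (E x (1, 0))) /= mul1r mul0r addr0.
- by rewrite (is_derive_val (E x (0, 1))) /= mul1r mul0r add0r.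
Qed.

Lemma is_derive_polyfun d f x w : polyfun d f ->
  is_derive x w f (w.1 * dx f x + w.2 * dy f x).
Proof.
by move=> /polyfun_is_derive[fx [fy [_ _ E]]]; have [-> ->] := polyfun_dE E.
Qed.

Lemma polyfun_dx d f : polyfun d f -> polyfun d.-1 (dx f).
Proof.
by move=> /polyfun_is_derive[fx [fy [? _ E]]]; have [-> _] := polyfun_dE E.
Qed.

Lemma polyfun_dy d f : polyfun d f -> polyfun d.-1 (dy f).
Proof.
by move=> /polyfun_is_derive[fx [fy [_ ? E]]]; have [_ ->] := polyfun_dE E.
Qed.

Lemma dxD d e f g : polyfun d f -> polyfun e g ->
  dx (fun x => f x + g x) = (fun x => dx f x + dx g x).
Proof.
move=> pf pg; apply/funext => x.
have h1 := is_derive_polyfun x (1, 0) pf.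
have h2 := is_derive_polyfun x (1, 0) pg.
by rewrite [in LHS]dx.unlock (is_derive_val (is_deriveD h1 h2)) /= !mul1r
  !mul0r !addr0.
Qed.

Lemma dyD d e f g : polyfun d f -> polyfun e g ->
  dy (fun x => f x + g x) = (fun x => dy f x + dy g x).
Proof.
move=> pf pg; apply/funext => x.
have h1 := is_derive_polyfun x (0, 1) pf.
have h2 := is_derive_polyfun x (0, 1) pg.
by rewrite [in LHS]dy.unlock (is_derive_val (is_deriveD h1 h2)) /= !mul1r
  !mul0r !add0r.
Qed.

Lemma dx_comb d (a b : R) f g : polyfun d f -> polyfun d g ->
  dx (fun x => a * f x + b * g x) = (fun x => a * dx f x + b * dx g x).
Proof.
move=> pf pg; apply/funext => x.
have h1 := is_deriveZ a (is_derive_polyfun x (1, 0) pf).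
have h2 := is_deriveZ b (is_derive_polyfun x (1, 0) pg).
rewrite [in LHS]dx.unlock (is_derive_val (is_deriveD h1 h2)).
by rewrite /= !mul1r !mul0r !addr0.
Qed.

Lemma dy_comb d (a b : R) f g : polyfun d f -> polyfun d g ->
  dy (fun x => a * f x + b * g x) = (fun x => a * dy f x + b * dy g x).
Proof.
move=> pf pg; apply/funext => x.
have h1 := is_deriveZ a (is_derive_polyfun x (0, 1) pf).
have h2 := is_deriveZ b (is_derive_polyfun x (0, 1) pg).
rewrite [in LHS]dy.unlock (is_derive_val (is_deriveD h1 h2)).
by rewrite /= !mul1r !mul0r !add0r.
Qed.

Lemma dxM d e f g : polyfun d f -> polyfun e g ->
  dx (fun x => f x * g x) = (fun x => f x * dx g x + g x * dx f x).
Proof.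
move=> pf pg; apply/funext => x.
have h1 := is_derive_polyfun x (1, 0) pf.
have h2 := is_derive_polyfun x (1, 0) pg.
by rewrite [in LHS]dx.unlock (is_derive_val (is_deriveM h1 h2)) /= !mul1r
  !mul0r !addr0.
Qed.

Lemma dyM d e f g : polyfun d f -> polyfun e g ->
  dy (fun x => f x * g x) = (fun x => f x * dy g x + g x * dy f x).
Proof.
move=> pf pg; apply/funext => x.
have h1 := is_derive_polyfun x (0, 1) pf.
have h2 := is_derive_polyfun x (0, 1) pg.
by rewrite [in LHS]dy.unlock (is_derive_val (is_deriveM h1 h2)) /= !mul1r
  !mul0r !add0r.
Qed.

Lemma dx_monom c a b : dx (fun x : R * R => c * x.1 ^+ a * x.2 ^+ b) =
  (fun x => (c * a%:R) * x.1 ^+ a.-1 * x.2 ^+ b).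
Proof.
by have [-> _] := polyfun_dE (is_derive_monom c a b).
Qed.

Lemma dy_monom c a b : dy (fun x : R * R => c * x.1 ^+ a * x.2 ^+ b) =
  (fun x => (c * b%:R) * x.1 ^+ a * x.2 ^+ b.-1).
Proof.
by have [_ ->] := polyfun_dE (is_derive_monom c a b).
Qed.

Lemma dxdyC d f : polyfun d f -> dx (dy f) = dy (dx f).
Proof.
elim=> [c a b ab|f1 f2 p1 E1 p2 E2].
  by rewrite dx_monom !dy_monom dx_monom; apply/funext => x; ring.
have px := polyfun_dx; have py := polyfun_dy.
rewrite (dyD p1 p2) (dxD p1 p2) (dxD (py _ _ p1) (py _ _ p2)).
by rewrite (dyD (px _ _ p1) (px _ _ p2)) E1 E2.
Qed.

Lemma polyfun_continuous d f : polyfun d f -> continuous f.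
Proof.
elim=> [c a b ab|f1 f2 _ c1 _ c2] x; last by apply: cvgD; [exact: c1|exact: c2].
have c1 : {for x, continuous (fun y : R * R => y.1 ^+ a)}.
  have h1 : {for x, continuous (fst : R * R -> R)} by exact: cvg_fst.
  have h2 : {for x.1, continuous (fun t : R =>
    t ^+ a)} by exact: exprn_continuous.
  exact: (continuous_comp h1 h2).
have c2 : {for x, continuous (fun y : R * R => y.2 ^+ b)}.
  have h1 : {for x, continuous (snd : R * R -> R)} by exact: cvg_snd.
  have h2 : {for x.2, continuous (fun t : R =>
    t ^+ b)} by exact: exprn_continuous.
  exact: (continuous_comp h1 h2).
by apply: cvgM c2; apply: cvgM c1; exact: cvg_cst.
Qed.

End polyfun_theory.

(** * Integrals over the reference triangle *)
Section triangle_integral.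
Context {R : realType}.
Implicit Types (f g : R * R -> R) (d e : nat).
Let mu := @lebesgue_measure R.

(** The product sigma-algebra has to be the one of [int_refT], whose factors
    are generated by the half-open intervals. *)
Lemma measurable_refT :
  measurable (refT : set (measurableTypeR R * measurableTypeR R)%type).
Proof.
have -> : (refT : set (R * R)) = (fst @^-1` `[0, +oo[) `&` (snd @^-1` `[0, +oo[)
    `&` ((fun x : R * R => x.1 + x.2) @^-1` `]-oo, 1]).
  apply/seteqP; split => x /=; rewrite !in_itv/= !andbT.
    by case.
  by case=> -[].
apply: measurableI; first apply: measurableI.
- by rewrite -[X in measurable X]setTI; exact: measurable_fst.
- by rewrite -[X in measurable X]setTI; exact: measurable_snd.
- rewrite -[X in measurable X]setTI.
  by apply: measurable_funD.
Qed.

Lemma polyfun_measurable d f : polyfun d f -> measurable_fun setT f.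
Proof.
elim=> [c a b ab|f1 f2 _ m1 _ m2]; last exact: measurable_funD.
apply: measurable_funM.
  apply: measurable_funM => //; apply: measurable_funX; exact: measurable_fst.
apply: measurable_funX; exact: measurable_snd.
Qed.

Lemma polyfun_bounded d f : polyfun d f ->
  exists M, forall x, refT x -> `|f x| <= M.
Proof.
elim=> [c a b ab|f1 f2 _ [M1 b1] _ [M2 b2]]; last first.
  exists (M1 + M2) => x Tx; rewrite (le_trans (ler_normD _ _))//.
  by rewrite lerD ?b1 ?b2.
exists `|c| => x [x1 x2 x12].
rewrite !normrM -mulrA ler_piMr// mulr_ile1//.
- by rewrite normrX exprn_ile1// ger0_norm//; lra.
- by rewrite normrX exprn_ile1// ger0_norm//; lra.
Qed.

Lemma refT_finite : ((mu \x mu) refT < +oo)%E.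
Proof.
have sub : (refT : set (R * R)) `<=` `[0, 1] `*` `[0, 1].
  by move=> x [x1 x2 x12]; split => /=; rewrite in_itv/=; lra.
apply: (@le_lt_trans _ _ ((mu \x mu)%E (`[0, 1] `*` `[0, 1]))).
  by apply: le_measure => //; rewrite inE;
    [exact: measurable_refT|exact: measurableX].
by rewrite product_measure1E//= /mu lebesgue_measure_itv/= lte_fin ltr01 oppr0
  adde0 mule1 ltry.
Qed.

Lemma polyfun_integrable d f : polyfun d f ->
  (mu \x mu)%E.-integrable refT (EFin \o f).
Proof.
move=> pf; have [M fM] := polyfun_bounded pf.
apply: measurable_bounded_integrable.
- exact: measurable_refT.
- exact: refT_finite.
- exact: measurable_funTS (polyfun_measurable pf).
- exists M; split; first exact: num_real.
  by move=> N /ltW MN x /fM fx; exact: le_trans MN.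
Qed.

Lemma eq_int_refT f g : (forall x, refT x -> f x = g x) ->
  int_refT f = int_refT g.
Proof. by move=> fg; apply: eq_Rintegral => x /[!inE]; exact: fg. Qed.

Lemma int_refTD d e f g : polyfun d f -> polyfun e g ->
  int_refT (fun x => f x + g x) = int_refT f + int_refT g.
Proof.
move=> pf pg; rewrite /int_refT RintegralD//; first exact: measurable_refT.
  exact: polyfun_integrable pf.
exact: polyfun_integrable pg.
Qed.

Lemma int_refTZ d f c : polyfun d f ->
  int_refT (fun x => c * f x) = c * int_refT f.
Proof.
move=> pf; rewrite /int_refT RintegralZl//; first exact: measurable_refT.
exact: polyfun_integrable pf.
Qed.

Lemma int_refTB d e f g : polyfun d f -> polyfun e g ->
  int_refT (fun x => f x - g x) = int_refT f - int_refT g.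
Proof.
move=> pf pg; rewrite /int_refT RintegralB//; first exact: measurable_refT.
  exact: polyfun_integrable pf.
exact: polyfun_integrable pg.
Qed.

(** The inner integrals are passed as an explicit function [h] because the
    fundamental theorem of calculus provides them in closed form. *)
Lemma int_refT_fubini12 d f (h : R -> R) : polyfun d f ->
  (forall x : R, 0 <= x <= 1 ->
    (\int[mu]_(y in `[0%R, (1 - x)%R]) (f (x, y))%:E = (h x)%:E)%E) ->
  int_refT f = \int[mu]_(x in `[0, 1]) h x.
Proof.
move=> pf fh; rewrite /int_refT /Rintegral; congr fine.
rewrite integral_mkcond -integral12_prod_meas1; last first.
  exact: (proj1 (integrable_mkcond _ measurable_refT) (polyfun_integrable pf)).
rewrite [RHS]integral_mkcond; apply: eq_integral => x _.
rewrite /fubini_F patchE; case: ifPn;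
  rewrite ?inE ?notin_setE/= in_itv/= => x01.
  rewrite -fh// [RHS]integral_mkcond; apply: eq_integral => y _.
  rewrite !patchE; congr (if _ then _ else _).
  by apply/idP/idP; rewrite !inE /= in_itv/=; [case=> /=; lra|move=> ?;
    split=> /=; lra].
apply: integral0_eq => y _; rewrite patchE; case: ifPn => //;
  rewrite inE => -[/= h1 h2 h3].
by exfalso; apply: x01; apply/andP; split; lra.
Qed.

Lemma int_refT_fubini21 d f (h : R -> R) : polyfun d f ->
  (forall y : R, 0 <= y <= 1 ->
    (\int[mu]_(x in `[0%R, (1 - y)%R]) (f (x, y))%:E = (h y)%:E)%E) ->
  int_refT f = \int[mu]_(y in `[0, 1]) h y.
Proof.
move=> pf fh; rewrite /int_refT /Rintegral; congr fine.
rewrite integral_mkcond -integral21_prod_meas1; last first.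
  exact: (proj1 (integrable_mkcond _ measurable_refT) (polyfun_integrable pf)).
rewrite [RHS]integral_mkcond; apply: eq_integral => x _.
rewrite /fubini_G patchE; case: ifPn;
  rewrite ?inE ?notin_setE/= in_itv/= => x01.
  rewrite -fh// [RHS]integral_mkcond; apply: eq_integral => y _.
  rewrite !patchE; congr (if _ then _ else _).
  by apply/idP/idP; rewrite !inE /= in_itv/=; [case=> /=; lra|move=> ?;
    split=> /=; lra].
apply: integral0_eq => y _; rewrite patchE; case: ifPn => //;
  rewrite inE => -[/= h1 h2 h3].
by exfalso; apply: x01; apply/andP; split; lra.
Qed.

Lemma continuous_derivable_oo (F : R -> R) (a b : R) :
  (forall t, derivable F t 1) -> derivable_oo_LRcontinuous F a b.
Proof.
move=> dF; have cF t : {for t, continuous F}.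
  by apply/differentiable_continuous/derivable1_diffP.
split; first by move=> t _; exact: dF.
- exact: cvg_at_right_filter (cF a).
- exact: cvg_at_left_filter (cF b).
Qed.

(** Restriction to a line reduces calculus in the plane to calculus in one
    real variable. *)
Lemma is_derive_line f (x w : R * R) (t l : R) :
  is_derive (t *: w + x) w f l -> is_derive t 1 (fun t => f (t *: w + x)) l.
Proof.
have E : (fun h : R => h^-1 *: (((fun t =>
  f (t *: w + x)) \o shift t) (h *: 1) -
      f (t *: w + x))) =
    (fun h : R => h^-1 *: ((f \o shift (t *: w + x)) (h *: w) - f (t *: w +
      x))).
  apply/funext => h /=; congr (_ *: (f _ - _)).
  by rewrite addrA -scalerDl; congr (_ *: _ + _); rewrite /GRing.scale/= mulr1.
by case=> df <-; apply: DeriveDef; rewrite /derivable /derive E.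
Qed.

Lemma polyfun_line_continuous d f (x w : R * R) : polyfun d f ->
  continuous (fun t : R => f (t *: w + x)).
Proof.
move=> pf t; apply/differentiable_continuous/derivable1_diffP.
by have [] := is_derive_line (is_derive_polyfun (t *: w + x) w pf).
Qed.

(** The fundamental theorem of calculus along a line; degenerate lines have to
    be allowed because the sections of the triangle shrink to a point. *)
Lemma integral_line_derive d f (x w : R * R) (a : R) : polyfun d f -> 0 <= a ->
  (\int[mu]_(t in `[0%R, a])
     (w.1 * dx f (t *: w + x) + w.2 * dy f (t *: w + x))%:E =
   (f (a *: w + x) - f x)%:E)%E.
Proof.
move=> pf; rewrite le_eqVlt => /predU1P[<-|a0].
  by rewrite set_itv1 integral_set1 scale0r add0r subrr.
have dF t := is_derive_line (is_derive_polyfun (t *: w + x) w pf).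
rewrite (@continuous_FTC2 _ _ (fun t => f (t *: w + x)))//.
- by rewrite scale0r add0r EFinB.
- apply: continuous_subspaceT => t.
  have cx := @polyfun_line_continuous _ _ x w (polyfun_dx pf) t.
  have cy := @polyfun_line_continuous _ _ x w (polyfun_dy pf) t.
  by apply: cvgD; [apply: cvgM cx|apply: cvgM cy]; exact: cvg_cst.
- by apply: continuous_derivable_oo => t; have [] := dF t.
- by move=> t _; rewrite derive1E; have [] := dF t.
Qed.

Lemma int_refT_dy d f : polyfun d f ->
  int_refT (dy f) = \int[mu]_(x in `[0, 1]) (f (x, 1 - x) - f (x, 0)).
Proof.
move=> pf; apply: (int_refT_fubini12 (polyfun_dy pf)) => x /andP[x0 x1].
have := @integral_line_derive _ _ (x, 0) (0, 1) (1 - x) pf.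
rewrite subr_ge0 => /(_ x1).
have E t : t *: (0, 1) + (x, 0) = (x, t) :> R * R.
  by apply: injective_projections;
    rewrite /= /GRing.scale/= ?mulr0 ?mulr1 ?add0r ?addr0.
rewrite E => <-; apply: eq_integral => t _.
by rewrite E mul0r add0r mul1r.
Qed.

Lemma int_refT_dx d f : polyfun d f ->
  int_refT (dx f) = \int[mu]_(y in `[0, 1]) (f (1 - y, y) - f (0, y)).
Proof.
move=> pf; apply: (int_refT_fubini21 (polyfun_dx pf)) => x /andP[x0 x1].
have := @integral_line_derive _ _ (0, x) (1, 0) (1 - x) pf.
rewrite subr_ge0 => /(_ x1).
have E t : t *: (1, 0) + (0, x) = (t, x) :> R * R.
  by apply: injective_projections;
    rewrite /= /GRing.scale/= ?mulr0 ?mulr1 ?add0r ?addr0.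
rewrite E => <-; apply: eq_integral => t _.
by rewrite E mul0r addr0 mul1r.
Qed.

End triangle_integral.

(** * Green's formula on the reference triangle *)
Section green.
Context {R : realType}.
Implicit Types (f g h : R * R -> R) (d e : nat).
Let mu := @lebesgue_measure R.

Lemma integrable01 (u : R -> R) : continuous u ->
  mu.-integrable `[0, 1] (EFin \o u).
Proof.
move=> cu; apply: continuous_compact_integrable; first exact: segment_compact.
exact: continuous_subspaceT.
Qed.

Lemma Rintegral01B (u v : R -> R) : continuous u -> continuous v ->
  \int[mu]_(t in `[0, 1]) (u t - v t) =
  \int[mu]_(t in `[0, 1]) u t - \int[mu]_(t in `[0, 1]) v t.
Proof. by move=> cu cv; rewrite RintegralB//; exact: integrable01. Qed.

Lemma Rintegral01N (u : R -> R) : continuous u ->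
  \int[mu]_(t in `[0, 1]) (- u t) = - \int[mu]_(t in `[0, 1]) u t.
Proof.
move=> cu; under eq_Rintegral do rewrite -mulN1r.
by rewrite RintegralZl ?mulN1r//; exact: integrable01.
Qed.

Lemma Rintegral01_onem (u : R -> R) : continuous u ->
  \int[mu]_(t in `[0, 1]) u (1 - t) = \int[mu]_(t in `[0, 1]) u t.
Proof.
move=> cu; rewrite [RHS](@Rintegration_by_substitution_onem _ u 1).
- by rewrite onem1.
- by rewrite ler01 lexx.
- exact: continuous_subspaceT.
Qed.

Definition ref_vertex (a : 'I_3) : R * R := ((a == 1)%:R, (a == 2)%:R).

Definition segment (a b : 'I_3) (t : R) : R * R :=
  t *: (ref_vertex b - ref_vertex a) + ref_vertex a.

Definition segment_derive (a b : 'I_3) h (t : R) : R :=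
  (ref_vertex b - ref_vertex a).1 * dx h (segment a b t) +
    (ref_vertex b - ref_vertex a).2 * dy h (segment a b t).

(** The integral of the 1-form f dh along the edge from vertex [a] to [b]. *)
Definition edge_integral f h (a b : 'I_3) : R :=
  \int[mu]_(t in `[0, 1]) (f (segment a b t) * segment_derive a b h t).

Lemma segment_refT a b t : 0 <= t <= 1 -> refT (segment a b t).
Proof.
move=> t01; rewrite /refT/= /segment/ref_vertex /= /GRing.scale/=.
by case: a => -[|[|[|//]]] ?; case: b => -[|[|[|//]]] ? /=; split; lra.
Qed.

Lemma segment_rev a b t : segment b a t = segment a b (1 - t).
Proof.
by apply: injective_projections; rewrite /segment /= /GRing.scale/=; ring.
Qed.

Lemma segment_derive_rev a b h t : segment_derive b a h t =
  - segment_derive a b h (1 - t).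
Proof. by rewrite /segment_derive segment_rev /=; ring. Qed.

Lemma is_derive_segment d h (a b : 'I_3) (t : R) : polyfun d h ->
  is_derive t 1 (fun t => h (segment a b t)) (segment_derive a b h t).
Proof. by move=> ph; apply: is_derive_line; exact: is_derive_polyfun ph. Qed.

Lemma segment_continuous d f a b : polyfun d f ->
  continuous (fun t => f (segment a b t)).
Proof. exact: polyfun_line_continuous. Qed.

Lemma edge_integrand_continuous d e f h a b : polyfun d f -> polyfun e h ->
  continuous (fun t => f (segment a b t) * segment_derive a b h t).
Proof.
move=> pf ph t; apply: (cvgM (@segment_continuous _ _ a b pf t)).
have cx := @segment_continuous _ _ a b (polyfun_dx ph) t.
have cy := @segment_continuous _ _ a b (polyfun_dy ph) t.
by apply: cvgD; [apply: cvgM cx|apply: cvgM cy]; exact: cvg_cst.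
Qed.

Lemma edge_integral_rev d e f h a b : polyfun d f -> polyfun e h ->
  edge_integral f h b a = - edge_integral f h a b.
Proof.
move=> pf ph; have c := @edge_integrand_continuous _ _ _ _ a b pf ph.
rewrite /edge_integral -Rintegral01N// -[RHS]Rintegral01_onem; last first.
  by move=> t; apply: cvgN; exact: c.
by apply: eq_Rintegral => t _; rewrite segment_rev segment_derive_rev mulrN.
Qed.

(** The coefficient of df /\ dh with respect to the area form of the plane. *)
Definition bracket f h (x : R * R) : R := dx f x * dy h x - dy f x * dx h x.

Lemma polyfun_bracket d f h : polyfun d f -> polyfun d h ->
  polyfun (d.-1 + d.-1) (bracket f h).
Proof.
move=> pf ph; apply: polyfunB; apply: polyfunM;
  by [exact: polyfun_dx|exact: polyfun_dy].
Qed.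

(** The Leibniz rule d(fg) /\ dh = f dg /\ dh + g df /\ dh. *)
Lemma bracketM d f g h x : polyfun d f -> polyfun d g ->
  bracket (fun x => f x * g x) h x = f x * bracket g h x + g x * bracket f h x.
Proof. by move=> pf pg; rewrite /bracket (dxM pf pg) (dyM pf pg); ring. Qed.

(** Stokes' formula for the 1-form f dh: the mixed second derivatives of [h]
    cancel in d(f dh) = df /\ dh, and each of the two remaining derivatives is
    integrated first in its own variable. *)
Lemma green_refT d e f h : polyfun d f -> polyfun e h ->
  int_refT (bracket f h) =
  \sum_(a < 3) edge_integral f h a (a + 1).
Proof.
move=> pf ph.
have phx := polyfun_dx ph; have phy := polyfun_dy ph.
have pQ := polyfunM pf phy; have pP := polyfunM pf phx.
have -> : bracket f h =
   (fun x => dx (fun x => f x * dy h x) x - dy (fun x => f x * dx h x) x).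
  apply/funext => x; rewrite /bracket (dxM pf phy) (dyM pf phx) (dxdyC ph).
  by ring.
rewrite (int_refTB (polyfun_dx pQ) (polyfun_dy pP)).
rewrite (int_refT_dx pQ) (int_refT_dy pP).
have c g d' a b : polyfun d' g -> continuous (fun t => g (segment a b t)).
  exact: segment_continuous.
have s01 t : segment 0 1 t = (t, 0).
  by apply: injective_projections; rewrite /segment/= /GRing.scale/=; ring.
have s12 t : segment 1 (1 + 1) t = (1 - t, t).
  by apply: injective_projections; rewrite /segment/= /GRing.scale/=; ring.
rewrite !big_ord_recl big_ord0 addr0.
have e0 : ord0 = 0 :> 'I_3 by [].
have e1 : lift ord0 ord0 = 1 :> 'I_3 by apply/val_inj.
have e2 : lift ord0 (lift ord0 ord0) = 1 + 1 :> 'I_3 by apply/val_inj.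
rewrite e2 e1 e0 add0r.
have -> : edge_integral f h 0 1 =
  \int[mu]_(t in `[0, 1]) (f (segment 0 1 t) * dx h (segment 0 1 t)).
  by apply: eq_Rintegral => t _; rewrite /segment_derive/=; ring.
have -> : edge_integral f h 1 (1 + 1) = \int[mu]_(t in `[0, 1])
   (f (segment 1 (1+1) t) * dy h (segment 1 (1 +
     1) t) - f (segment 1 (1+1) t) * dx h (segment 1 (1 + 1) t)).
  by apply: eq_Rintegral => t _; rewrite /segment_derive/=; ring.
have -> : edge_integral f h (1 + 1) (1 + 1 + 1) = \int[mu]_(t in `[0, 1])
   - (f (segment (1+1) (1+1+1) t) * dy h (segment (1+1) (1 + 1+1) t)).
  by apply: eq_Rintegral => t _; rewrite /segment_derive/=; ring.
have cQ a b := c _ _ a b pQ; have cP a b := c _ _ a b pP.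
have s02 t : segment 0 (1 + 1) t = (0, t).
  by apply: injective_projections; rewrite /segment/= /GRing.scale/=; ring.
have s21 t : segment (1 + 1) 1 t = (t, 1 - t).
  by apply: injective_projections; rewrite /segment/= /GRing.scale/=; ring.
have -> : \int[mu]_(t in `[0, 1]) (f (1 - t, t) * dy h (1 - t, t) -
    f (0, t) * dy h (0, t)) =
  \int[mu]_(t in `[0, 1]) (f (segment 1 (1 + 1) t) * dy h (segment 1 (1 +
    1) t)) -
  \int[mu]_(t in `[0, 1]) (f (segment 0 (1 + 1) t) * dy h (segment 0 (1 +
    1) t)).
  rewrite -(Rintegral01B (cQ _ _) (cQ _ _)).
  by apply: eq_Rintegral => t _; rewrite s12 s02.
have -> : \int[mu]_(t in `[0, 1]) (f (t, 1 - t) * dx h (t, 1 - t) -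
    f (t, 0) * dx h (t, 0)) =
  \int[mu]_(t in `[0, 1]) (f (segment (1 + 1) 1 t) * dx h (segment (1 +
    1) 1 t)) -
  \int[mu]_(t in `[0, 1]) (f (segment 0 1 t) * dx h (segment 0 1 t)).
  rewrite -(Rintegral01B (cP _ _) (cP _ _)).
  by apply: eq_Rintegral => t _; rewrite s21 s01.
rewrite (Rintegral01B (cQ _ _) (cP _ _)) (Rintegral01N (cQ _ _)).
rewrite -(Rintegral01_onem (cP (1 + 1) 1)) -(Rintegral01_onem (cQ 0 (1 + 1))).
have -> : \int[mu]_(t in `[0,
  1]) (f (segment (1 + 1) 1 (1 - t)) * dx h (segment (1 + 1) 1 (1 - t)))
  = \int[mu]_(t in `[0, 1]) (f (segment 1 (1 + 1) t) * dx h (segment 1 (1 +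
    1) t)).
  by apply: eq_Rintegral => t _; rewrite -segment_rev.
have -> : \int[mu]_(t in `[0,
  1]) (f (segment 0 (1 + 1) (1 - t)) * dy h (segment 0 (1 + 1) (1 - t)))
  = \int[mu]_(t in `[0, 1]) (f (segment (1 + 1) (1 + 1 +
    1) t) * dy h (segment (1 + 1) (1 + 1 + 1) t)).
  by apply: eq_Rintegral => t _; rewrite -segment_rev.
by ring.
Qed.

End green.

(** * Vector algebra *)
Section vector_algebra.
Context {R : realType}.
Implicit Types u v w : 'rV[R]_3.

Lemma mxdotE u v :
  mxdot u v = u 0 0 * v 0 0 + u 0 1 * v 0 1 + u 0 2 * v 0 2.
Proof.
rewrite /mxdot big_ord_recl big_ord0 addr0 !big_ord_recl big_ord0 addr0 addrA.
have -> : lift ord0 (lift ord0 ord0) = 2 :> 'I_3 by exact/val_inj.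
by have -> : lift ord0 ord0 = 1 :> 'I_3 by exact/val_inj.
Qed.

Lemma ord3E : ((1 + 1)%R = 2%R :> 'I_3) * ((1 + 2)%R = 0%R :> 'I_3) *
  ((2 + 1)%R = 0%R :> 'I_3) * ((2 + 2)%R = 1%R :> 'I_3).
Proof. by repeat split; apply/val_inj. Qed.

Lemma cross0E u v : cross u v 0 0 = u 0 1 * v 0 2 - u 0 2 * v 0 1.
Proof. by rewrite mxE !add0r. Qed.

Lemma cross1E u v : cross u v 0 1 = u 0 2 * v 0 0 - u 0 0 * v 0 2.
Proof. by rewrite mxE !ord3E. Qed.

Lemma cross2E u v : cross u v 0 2 = u 0 0 * v 0 1 - u 0 1 * v 0 0.
Proof. by rewrite mxE !ord3E. Qed.

Lemma row3P u v : u 0 0 = v 0 0 -> u 0 1 = v 0 1 -> u 0 2 = v 0 2 -> u = v.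
Proof.
move=> u0 u1 u2; apply/rowP => i.
case: i => -[|[|[|//]]] ilt.
- by rewrite (_ : Ordinal ilt = 0)//; exact/val_inj.
- by rewrite (_ : Ordinal ilt = 1)//; exact/val_inj.
- by rewrite (_ : Ordinal ilt = 2)//; exact/val_inj.
Qed.

Definition vecE := (mxdotE, cross0E, cross1E, cross2E).

(** Lagrange's identity. *)
Lemma mxdot_cross u v :
  mxdot (cross u v) (cross u v) = mxdot u u * mxdot v v - mxdot u v ^+ 2.
Proof. by rewrite !vecE; ring. Qed.

Lemma cross_comb (a b c d : R) u v :
  cross (a *: u + b *: v) (c *: u + d *: v) = (a * d - b * c) *: cross u v.
Proof. by apply: row3P; rewrite !mxE ?ord3E ?add0r; ring. Qed.

Lemma mxdotC m n (A B : 'M[R]_(m, n)) : mxdot A B = mxdot B A.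
Proof. by apply: eq_bigr => i _; apply: eq_bigr => k _; rewrite mulrC. Qed.

Lemma mxdotDr m n (A B C : 'M[R]_(m, n)) :
  mxdot A (B + C) = mxdot A B + mxdot A C.
Proof.
rewrite -big_split/=; apply: eq_bigr => i _.
by rewrite -big_split/=; apply: eq_bigr => k _; rewrite mxE mulrDr.
Qed.

Lemma mxdot_ge0 m n (A : 'M[R]_(m, n)) : 0 <= mxdot A A.
Proof.
by apply: sumr_ge0 => i _; apply: sumr_ge0 => k _; rewrite -expr2 sqr_ge0.
Qed.

Lemma enorm_ge0 m n (A : 'M[R]_(m, n)) : 0 <= enorm A.
Proof. exact: sqrtr_ge0. Qed.

Lemma sqr_enorm m n (A : 'M[R]_(m, n)) : enorm A ^+ 2 = mxdot A A.
Proof. by rewrite sqr_sqrtr// mxdot_ge0. Qed.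

Lemma enormZ m n (c : R) (A : 'M[R]_(m, n)) : enorm (c *: A) = `|c| * enorm A.
Proof.
rewrite /enorm mxdotZr mxdotC mxdotZr mulrA -expr2 sqrtrM ?sqr_ge0//.
by rewrite sqrtr_sqr.
Qed.

(** By Lagrange's identity the area is at most the product of the lengths of
    the sides, hence at most the mean of their squares. *)
Lemma enorm_cross_le u v : enorm (cross u v) <= 2^-1 * (mxdot u u + mxdot v v).
Proof.
rewrite -(@ler_pXn2r _ 2)// ?nnegrE ?enorm_ge0//; last first.
  by rewrite mulr_ge0 ?addr_ge0 ?mxdot_ge0.
rewrite sqr_enorm mxdot_cross.
have := sqr_ge0 (mxdot u v); have := sqr_ge0 (mxdot u u - mxdot v v).
by nra.
Qed.

Lemma mxdot_tensor (a b s t : 'rV[R]_3) :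
  mxdot (a^T *m s) (b^T *m t) = mxdot a b * mxdot s t.
Proof.
rewrite /mxdot !big_ord1 mulr_suml; apply: eq_bigr => i _.
by rewrite mulr_sumr; apply: eq_bigr => k _; rewrite !mxE !big_ord1 !mxE; ring.
Qed.

End vector_algebra.

(** * One-sided derivatives *)

Lemma dwithin_eq {R : realType} {U V : normedModType R} (S : set U) (v : U)
    (f g : U -> V) (z : U) :
  (forall y, S y -> 'D_v f y = g y) -> {for z, continuous g} -> closure S z ->
  dwithin S v f z = g z.
Proof.
move=> fg cg Sz; apply: cvg_lim => //.
apply: (@cvg_trans _ (g @ within S (nbhs z))); last exact: cvg_within_filter.
apply: near_eq_cvg; near=> y; apply/esym/fg.
by near: y; exact: withinT.
Unshelve. all: by end_near. Qed.

Section one_sided_derivative.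
Context {R : realType}.

(** Used with the segment from a point of the closed triangle to the
    barycentre, all of whose other points are interior. *)
Lemma closure_segment (U : normedModType R) (S : set U) (v z : U) :
  (forall t : R, 0 < t < 1 -> S (t *: v + z)) -> closure S z.
Proof.
move=> Sp B Bz.
have cp : (t *: v + z) @[t --> (0:R)^'+] --> z.
  rewrite -[X in _ --> X]add0r -[X in _ --> X + _](scale0r v).
  apply: cvgD; last exact: cvg_cst.
  by apply: cvgZr_tmp; apply: cvg_at_right_filter; exact: cvg_id.
near ((0 : R)^'+) => t; exists (t *: v + z); split.
  by apply: Sp; apply/andP; split; near: t;
    [exact: nbhs_right_gt|exact: nbhs_right_lt].
by near: t; exact: cp.
Unshelve. all: by end_near. Qed.

Lemma refT_open_segment (x : R * R) (t : R) : refT x -> 0 < t < 1 ->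
  refT_open (t *: ((3^-1, 3^-1) - x) + x).
Proof.
case: x => x1 x2 [/= x10 x20 x12] /andP[t0 t1];
  rewrite /refT_open/= /GRing.scale/=.
by split; nra.
Qed.

Lemma nbhs_refT_open (x : R * R) : refT_open x ->
  \forall y \near x, refT_open y.
Proof.
move=> [x1 x2 x12].
have c1 : {for x, continuous (fst : R * R -> R)} by exact: cvg_fst.
have c2 : {for x, continuous (snd : R * R -> R)} by exact: cvg_snd.
have c3 : {for x, continuous (fun y : R * R =>
  y.1 + y.2)} by exact: (cvgD c1 c2).
near=> y; split; near: y.
- exact: cvgr_gt c1 _ x1.
- exact: cvgr_gt c2 _ x2.
- exact: cvgr_lt c3 _ x12.
Unshelve. all: by end_near. Qed.

Lemma refT_openW (x : R * R) : refT_open x -> refT x.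
Proof. by case=> *; split; exact: ltW. Qed.

Lemma derive_refT_open (V : normedModType R) (f F : R * R -> V) (w x : R * R) :
  (forall y, refT y -> f y = F y) -> refT_open x -> 'D_w f x = 'D_w F x.
Proof.
move=> fF Tx; apply: near_eq_derive.
by near=> y; apply/fF/refT_openW; near: y; exact: nbhs_refT_open.
Unshelve. all: by end_near. Qed.

Lemma dwithin_refT (V : normedModType R) (f F DF : R * R -> V) (w x : R * R) :
  (forall y, refT y -> f y = F y) -> (forall y, is_derive y w F (DF y)) ->
  {for x, continuous DF} -> refT x -> dwithin refT_open w f x = DF x.
Proof.
move=> fF dF cF Tx; apply: dwithin_eq => //.
  by move=> y Ty; rewrite (derive_refT_open w fF Ty); case: (dF y).
apply: (@closure_segment _ _ ((3^-1, 3^-1) - x)) => t t01.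
exact: refT_open_segment.
Qed.

End one_sided_derivative.

(** * Affine charts of the triangles *)
Section chart.
Context {R : realType} (G : ref_surface R).
Implicit Types (j : 'I_(ntri G)) (w x : R * R).

Definition side1 j : 'rV[R]_3 := vtx j 1 - vtx j 0.
Definition side2 j : 'rV[R]_3 := vtx j 2 - vtx j 0.
Definition tangent j w : 'rV[R]_3 := w.1 *: side1 j + w.2 *: side2 j.
Definition facet_normal j := cross (side1 j) (side2 j).
Definition area j : R := enorm (facet_normal j).
Definition frame_normal j := cross (frame j 0) (frame j 1).
(** The sign +1 or -1 (see [orient_sqr]) that tells whether the numbering of
    the vertices agrees with the orientation of the surface. *)
Definition orient j : R := mxdot (frame_normal j) (facet_normal j) / area j.

Lemma chartE j w x (h : R) : chart j (h *: w + x) =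
  h *: tangent j w + chart j x.
Proof.
rewrite /chart /affmap /tangent /side1 /side2 /=.
by apply: row3P; rewrite !mxE /GRing.scale/=; ring.
Qed.

Lemma tangent_toP j v : tangent_to (vtx j) v <-> exists w, v = tangent j w.
Proof.
split=> [[a [b ->]]|[w ->]]; first by exists (a, b).
by exists w.1, w.2.
Qed.

Lemma frame_normal_unit j : mxdot (frame_normal j) (frame_normal j) = 1.
Proof.
by rewrite mxdot_cross !frame_orthonormal !eqxx /= expr0n/= subr0 mulr1.
Qed.

(** The frame has unit area, so its determinant in the basis of the two sides
    is the signed inverse of the area that these span. *)
Lemma frame_tangentE j : exists a b : R * R,
  [/\ frame j 0 = tangent j a, frame j 1 = tangent j b &
      a.1 * b.2 - a.2 * b.1 = orient j / area j /\ area j > 0 /\ orient j ^+ 2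
        = 1].
Proof.
have /tangent_toP[a Ea] := frame_tangent j 0.
have /tangent_toP[b Eb] := frame_tangent j 1.
exists a, b; split=> //.
have E : frame_normal j = (a.1 * b.2 - a.2 * b.1) *: facet_normal j.
  by rewrite /frame_normal Ea Eb /tangent cross_comb.
set k := _ - _ in E *.
have := frame_normal_unit j; rewrite E mxdotZr mxdotC mxdotZr -sqr_enorm.
rewrite -/(area j) => Ek.
have a0 : area j != 0.
  apply/eqP => a0; move: Ek; rewrite a0 expr0n/= !mulr0 => /eqP.
  by rewrite eq_sym oner_eq0.
have ap : 0 < area j by rewrite lt_def a0 enorm_ge0.
have Eo : orient j = k * area j.
  rewrite /orient E mxdotC mxdotZr -sqr_enorm -/(area j); field.
  exact: a0.
rewrite Eo; split; first by field.
by split=> //; rewrite -Ek; ring.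
Qed.

Lemma area_gt0 j : 0 < area j.
Proof. by have [a [b [_ _ [_ []]]]] := frame_tangentE j. Qed.

Lemma orient_sqr j : orient j ^+ 2 = 1.
Proof. by have [a [b [_ _ [_ []]]]] := frame_tangentE j. Qed.

(** The coordinates in the basis of the sides, obtained from the dual basis;
    unlike an abstract inverse of the chart this is visibly continuous on all
    of R^3. *)
Definition chart_inv j (z : 'rV[R]_3) : R * R :=
  let N := facet_normal j in
  (mxdot (z - vtx j 0) (cross (side2 j) N) / mxdot N N,
   mxdot (z - vtx j 0) (cross N (side1 j)) / mxdot N N).

Lemma chart_invK j : cancel (chart j) (chart_inv j).
Proof.
move=> x; have N0 : mxdot (facet_normal j) (facet_normal j) != 0.
  by rewrite -sqr_enorm expf_neq0// gt_eqF// area_gt0.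
apply: injective_projections; rewrite /chart_inv /=; apply: (mulIf N0).
  rewrite mulfVK// /chart /affmap /facet_normal -/(side1 j) -/(side2 j).
  by rewrite !vecE !mxE ?ord3E ?add0r; ring.
rewrite mulfVK// /chart /affmap /facet_normal -/(side1 j) -/(side2 j).
by rewrite !vecE !mxE ?ord3E ?add0r; ring.
Qed.

Lemma mxdot_continuous (p u : 'rV[R]_3) :
  continuous (fun z : 'rV[R]_3 => mxdot (z - p) u).
Proof.
move=> z.
have -> : (fun z : 'rV[R]_3 => mxdot (z - p) u) = (fun z : 'rV[R]_3 =>
    z 0 0 * u 0 0 + z 0 1 * u 0 1 + z 0 2 * u 0 2 - mxdot p u).
  by apply/funext => y; rewrite !vecE !mxE; ring.
have c k : {for z, continuous (fun z : 'rV[R]_3 => z 0 k * u 0 k)}.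
  have ck := @coord_continuous R 1 3 0 k z.
  by apply: (cvgM ck); exact: cvg_cst.
apply: (cvgB (cvgD (cvgD (c 0) (c 1)) (c 2))).
exact: cvg_cst.
Qed.

Lemma chart_inv_continuous j : continuous (chart_inv j).
Proof.
move=> z; have c u : {for z, continuous (fun y : 'rV[R]_3 =>
    mxdot (y - vtx j 0) u / mxdot (facet_normal j) (facet_normal j))}.
  by apply: (cvgM (@mxdot_continuous (vtx j 0) u z)); exact: cvg_cst.
exact: (cvg_pair (c _) (c _)).
Qed.

Lemma closure_chart j x : refT x ->
  closure (chart j @` refT_open) (chart j x).
Proof.
move=> Tx; apply: (@closure_segment _ _ _ (tangent j ((3^-1, 3^-1) - x))) =>
  t t01.
by exists (t *: ((3^-1, 3^-1) - x) + x);
  [exact: refT_open_segment|exact: chartE].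
Qed.

(** On the open element the two difference quotients coincide, and [chart_inv]
    carries the derivative of [F] to a continuous function around the point,
    whose value is the one-sided limit even on the boundary of the element. *)
Lemma dtan_chart j (V : normedModType R) (f : 'rV[R]_3 -> V)
    (F DF : R * R -> V) w x :
  (forall y, refT y -> f (chart j y) = F y) ->
  (forall y, is_derive y w F (DF y)) -> continuous DF -> refT x ->
  dtan j (tangent j w) f (chart j x) = DF x.
Proof.
move=> fF dF cF Tx.
rewrite /dtan (@dwithin_eq _ _ _ _ _ f (DF \o chart_inv j)) /= ?chart_invK//.
- move=> _ [y Ty <-]; rewrite /= chart_invK.
  have <- : 'D_w F y = DF y by case: (dF y).
  rewrite -(@derive_refT_open _ _ (f \o chart j) F w y fF Ty).
  rewrite /derive/=.
  by under [in RHS]eq_fun do rewrite chartE.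
- exact: (continuous_comp (@chart_inv_continuous j (chart j x)) (cF _)).
- exact: closure_chart.
Qed.

(** * Finite element functions in charts *)

Definition represents j (d : nat) (f : 'rV[R]_3 -> R) (F : R * R -> R) : Prop :=
  polyfun d F /\ forall x, refT x -> f (chart j x) = F x.

Definition represents3 j (d : nat) (Y : 'rV[R]_3 -> 'rV[R]_3) (F : 'I_3 ->
  R * R -> R)
  : Prop := forall k, represents j d (fun z => Y z 0 k) (F k).

Lemma fe_space_represents j d f : fe_space G d f ->
  exists F, represents j d f F.
Proof.
by case=> _ /(_ j)/poly_refT_polyfun[F pF FE]; exists F; split.
Qed.

Lemma fe_space3_represents j d Y : fe_space3 G d Y ->
  exists F, represents3 j d Y F.
Proof.
move=> hY.
have /choice[F FY] : forall k, exists F, represents j d (fun z => Y z 0 k) F.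
  by move=> k; exact: fe_space_represents (hY k).
by exists F.
Qed.

Definition grad_dx (F : 'I_3 -> R * R -> R) (x : R * R) : 'rV[R]_3 :=
  \row_k dx (F k) x.
Definition grad_dy (F : 'I_3 -> R * R -> R) (x : R * R) : 'rV[R]_3 :=
  \row_k dy (F k) x.

Lemma polyfun_dir_continuous d F w : polyfun d F ->
  continuous (fun x => w.1 * dx F x + w.2 * dy F x).
Proof.
move=> pF; apply: (@polyfun_continuous _ d.-1).
by apply: polyfunD; apply: polyfunZ; [exact: polyfun_dx|exact: polyfun_dy].
Qed.

Lemma row_continuous (T : topologicalType) (u : 'I_3 -> T -> R) :
  (forall k, continuous (u k)) -> continuous (fun t : T => \row_k u k t).
Proof.
move=> cu t.
have -> : (fun t : T => \row_k u k t) = (fun t : T => u 0 t *: delta_mx 0 0 +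
   u 1 t *: delta_mx 0 1 + u 2 t *: (delta_mx 0 2 : 'rV[R]_3)).
  by apply/funext => y; apply: row3P; rewrite !mxE/=; ring.
have c k : {for t, continuous (fun t : T =>
  u k t *: (delta_mx 0 k : 'rV[R]_3))}.
  by apply: cvgZr_tmp; exact: cu.
exact: (cvgD (cvgD (c 0) (c 1)) (c 2)).
Qed.

Lemma is_derive_row (U : normedModType R) (u : U -> 'rV[R]_3) (p v : U)
    (l : 'I_3 -> R) :
  (forall k, is_derive p v (fun y : U => u y 0 k) (l k)) ->
  is_derive p v u (\row_k l k).
Proof.
move=> du.
have d : derivable u p v.
  apply/derivable_mxP => i k; rewrite (ord1 i).
  by have [] := du k.
apply: DeriveDef => //; rewrite derive_mx//; apply/rowP => k; rewrite !mxE.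
by have [] := du k.
Qed.

Lemma is_derive_grad d F x w : (forall k, polyfun d (F k)) ->
  is_derive x w (fun x => \row_k F k x) (w.1 *: grad_dx F x +
    w.2 *: grad_dy F x).
Proof.
move=> pF; have -> : w.1 *: grad_dx F x + w.2 *: grad_dy F x =
    \row_k (w.1 * dx (F k) x + w.2 * dy (F k) x).
  by apply/rowP => k; rewrite !mxE.
apply: is_derive_row => k; under [fun y => _]eq_fun do rewrite mxE.
exact: is_derive_polyfun (pF k).
Qed.

Lemma grad_continuous d F w : (forall k, polyfun d (F k)) ->
  continuous (fun x => w.1 *: grad_dx F x + w.2 *: grad_dy F x).
Proof.
move=> pF; have -> : (fun x => w.1 *: grad_dx F x + w.2 *: grad_dy F x) =
    (fun x => \row_k (w.1 * dx (F k) x + w.2 * dy (F k) x)).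
  by apply/funext => x; apply/rowP => k; rewrite !mxE.
apply: row_continuous => k; exact: polyfun_dir_continuous (pF k).
Qed.

Lemma represents3_row j d Y F : represents3 j d Y F ->
  forall x, refT x -> Y (chart j x) = \row_k F k x.
Proof.
by move=> YF x Tx; apply/rowP => k; rewrite mxE; case: (YF k) => _ ->.
Qed.

Lemma dtan_represents3 j d Y F w x : represents3 j d Y F -> refT x ->
  dtan j (tangent j w) Y (chart j x) = w.1 *: grad_dx F x + w.2 *: grad_dy F x.
Proof.
move=> YF Tx; apply: (dtan_chart (represents3_row YF) _ _ Tx (DF :=
  fun x => _)).
  by move=> y; apply: is_derive_grad => k; case: (YF k) => pF _; exact: pF.
by apply: grad_continuous => k; case: (YF k) => pF _; exact: pF.
Qed.

Lemma jac_param_represents3 j d Y F x : represents3 j d Y F -> refT x ->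
  jac_param (Y \o chart j) x = cross (grad_dx F x) (grad_dy F x).
Proof.
move=> YF Tx; have pF k : polyfun d (F k) by case: (YF k).
have D w : dwithin refT_open w (Y \o chart j) x =
  w.1 *: grad_dx F x + w.2 *: grad_dy F x.
  apply: (dwithin_refT (represents3_row YF) _ _ Tx (DF := fun x => _)).
    by move=> y; exact: is_derive_grad pF.
  exact: grad_continuous.
by rewrite /jac_param !D /= !scale1r !scale0r addr0 add0r.
Qed.

(** The geometric and the parametric Jacobian are parallel: passing from the
    sides of the triangle to its frame multiplies the cross product by a
    determinant. *)
Lemma jac_represents3 j d Y F x : represents3 j d Y F -> refT x ->
  jac Y j (chart j x) = (orient j / area j) *: cross (grad_dx F x) (grad_dy F
    x).
Proof.
move=> YF Tx; rewrite /jac.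
have [a [b [-> -> [<- _]]]] := frame_tangentE j.
by rewrite !(dtan_represents3 _ YF Tx) cross_comb.
Qed.

Lemma enorm_jac_param j d Y F x : represents3 j d Y F -> refT x ->
  enorm (jac_param (Y \o chart j) x) = area j * enorm (jac Y j (chart j x)).
Proof.
move=> YF Tx; rewrite (jac_param_represents3 YF Tx) (jac_represents3 YF Tx)
  enormZ.
rewrite normrM normfV (gtr0_norm (area_gt0 j)).
have -> : `|orient j| = 1.
  by apply/eqP; rewrite -sqrp_eq1// real_normK ?num_real// orient_sqr.
rewrite mul1r mulVKf ?gt_eqF ?area_gt0//.
Qed.

End chart.

Section fe_space_theory.
Context {R : realType} (G : ref_surface R).

Lemma fe_space_comb d (a b : R) (f g : 'rV[R]_3 -> R) :
  fe_space G d f -> fe_space G d g -> fe_space G d (fun z => a * f z + b * g z).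
Proof.
move=> [cf pf] [cg pg]; split.
  by move=> z; apply: cvgD; apply: cvgM; try exact: cvg_cst;
    [exact: cf|exact: cg].
move=> j.
have [F pF fF] := poly_refT_polyfun (pf j).
have [F' pF' gF'] := poly_refT_polyfun (pg j).
have [c E] := polyfun_poly_refT (polyfun_comb a b pF pF').
by exists c => x Tx; rewrite -E//= -fF// -gF'.
Qed.

Lemma fe_space_cst d (c : R) : fe_space G d (fun=> c).
Proof.
split; first by move=> z; exact: cvg_cst.
by move=> j; exact: (polyfun_poly_refT (polyfun_cst d c)).
Qed.

Lemma fe_space3_comb d (a b : R) Y Z : fe_space3 G d Y -> fe_space3 G d Z ->
  fe_space3 G d (fun z => a *: Y z + b *: Z z).
Proof.
move=> hY hZ k; have := fe_space_comb a b (hY k) (hZ k).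
by congr (fe_space _ _ _); apply/funext => z; rewrite !mxE.
Qed.

Lemma represents_comb (j : 'I_(ntri G)) d a b f g F F' :
  represents j d f F -> represents j d g F' ->
  represents j d (fun z => a * f z + b * g z) (fun x => a * F x + b * F' x).
Proof.
move=> [pF fF] [pF' gF']; split; first exact: polyfun_comb.
by move=> x Tx; rewrite fF// gF'.
Qed.

Lemma represents3_comb (j : 'I_(ntri G)) d a b Y Z F F' :
  represents3 j d Y F -> represents3 j d Z F' ->
  represents3 j d (fun z => a *: Y z + b *: Z z) (fun k x =>
    a * F k x + b * F' k x).
Proof.
move=> hY hZ k; have := represents_comb a b (hY k) (hZ k).
by congr (represents _ _ _ _); apply/funext => z; rewrite !mxE.
Qed.

Lemma grad_dx_comb d a b (F F' : 'I_3 -> R * R -> R) x :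
  (forall k, polyfun d (F k)) -> (forall k, polyfun d (F' k)) ->
  grad_dx (fun k x => a * F k x + b * F' k x) x =
    a *: grad_dx F x + b *: grad_dx F' x.
Proof.
by move=> pF pF'; apply/rowP => k; rewrite !mxE (dx_comb a b (pF k) (pF' k)).
Qed.

Lemma grad_dy_comb d a b (F F' : 'I_3 -> R * R -> R) x :
  (forall k, polyfun d (F k)) -> (forall k, polyfun d (F' k)) ->
  grad_dy (fun k x => a * F k x + b * F' k x) x =
    a *: grad_dy F x + b *: grad_dy F' x.
Proof.
by move=> pF pF'; apply/rowP => k; rewrite !mxE (dy_comb a b (pF k) (pF' k)).
Qed.

End fe_space_theory.

(** * Decay of the area *)
Section energy.
Context {R : realType}.

Definition orthonormal_pair (s t : 'rV[R]_3) :=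
  [/\ mxdot s s = 1, mxdot t t = 1 & mxdot s t = 0].

(** Gram-Schmidt; this makes the choice in [surf_frame] meaningful. *)
Lemma orthonormal_combination (p q : 'rV[R]_3) : enorm (cross p q) != 0 ->
  exists a b : R * R,
    orthonormal_pair (a.1 *: p + a.2 *: q) (b.1 *: p + b.2 *: q).
Proof.
move=> pq0.
have c0 : 0 < mxdot (cross p q) (cross p q).
  by rewrite -sqr_enorm exprn_even_gt0.
have L := mxdot_cross p q.
have p0 : 0 < mxdot p p.
  rewrite lt_def mxdot_ge0 andbT; apply/eqP => p0.
  by move: c0; rewrite L p0 mul0r sub0r oppr_gt0 ltNge sqr_ge0.
pose P := Num.sqrt (mxdot p p);
  pose N := Num.sqrt (mxdot (cross p q) (cross p q)).
have P0 : P != 0 by rewrite gt_eqF// sqrtr_gt0.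
have N0 : N != 0 by rewrite gt_eqF// sqrtr_gt0.
have PP : P ^+ 2 = mxdot p p by rewrite sqr_sqrtr// ltW.
have NN : N ^+ 2 = P ^+ 2 * mxdot q q - mxdot p q ^+ 2.
  by rewrite sqr_sqrtr ?ltW// L PP.
have qq : mxdot q q = (N ^+ 2 + mxdot p q ^+ 2) / P ^+ 2 by rewrite NN; field.
(* p / |p|, and the component of q orthogonal to p, whose length is
   |p x q| / |p|, normalized *)
exists (P^-1, 0), (- mxdot p q / (P * N), P / N).
have E (a b : R * R) : mxdot (a.1 *: p + a.2 *: q) (b.1 *: p + b.2 *: q) =
    a.1 * b.1 * mxdot p p + (a.1 * b.2 + a.2 * b.1) * mxdot p q +
    a.2 * b.2 * mxdot q q.
  by rewrite !mxdotE !mxE; ring.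
by split; rewrite E /= ?qq -?PP; field; rewrite ?P0 ?N0.
Qed.

(** The discrete counterpart of the convexity of the Dirichlet energy and of
    its domination of the area.  With t1, t2 orthonormal and z1, z2 the images
    of the same parameter vectors, z.(z - t) >= (|z|^2 - |t|^2)/2 gives z1.(z1
    - t1) + z2.(z2 - t2) >= (|z1|^2 + |z2|^2)/2 - 1 >= |z1 x z2| - 1;
    multiplying by |p x q|, the inverse of the determinant of the parameter
    vectors, turns the right-hand side into a difference of area elements. *)
Lemma area_increment (p q p' q' : 'rV[R]_3) (a b : R * R) :
  let t1 := a.1 *: p + a.2 *: q in let t2 := b.1 *: p + b.2 *: q in
  let z1 := a.1 *: p' + a.2 *: q' in let z2 := b.1 *: p' + b.2 *: q' in
  orthonormal_pair t1 t2 ->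
  enorm (cross p' q') - enorm (cross p q) <=
  (mxdot z1 (z1 - t1) + mxdot z2 (z2 - t2)) * enorm (cross p q).
Proof.
move=> t1 t2 z1 z2 [t11 t22 t12].
pose D := a.1 * b.2 - a.2 * b.1.
have D1 : `|D| * enorm (cross p q) = 1.
  rewrite -enormZ -cross_comb -/t1 -/t2.
  by rewrite /enorm mxdot_cross t11 t22 t12 expr0n/= subr0 mulr1 sqrtr1.
have D2 : `|D| * enorm (cross p' q') = enorm (cross z1 z2).
  by rewrite -enormZ -cross_comb.
(* z.(z - t) = (|z|^2 - |t|^2 + |z - t|^2) / 2 *)
have young (z t : 'rV[R]_3) : mxdot t t = 1 ->
    2^-1 * mxdot z z - 2^-1 <= mxdot z (z - t).
  have := mxdot_ge0 (z - t); rewrite !mxdotE !mxE; lra.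
have := enorm_cross_le z1 z2; rewrite -D2.
have := young z1 t1 t11; have := young z2 t2 t22.
set X := mxdot z1 (z1 - t1); set X' := mxdot z2 (z2 - t2).
set A := mxdot z1 z1; set A' := mxdot z2 z2 => h1 h2 h3.
have h : `|D| * enorm (cross p' q') - 1 <= X + X' by lra.
have c0 := enorm_ge0 (cross p q).
have -> : enorm (cross p' q') - enorm (cross p q) =
    (`|D| * enorm (cross p' q') - 1) * enorm (cross p q).
  by rewrite mulrBl mulrAC D1 !mul1r.
exact: ler_wpM2r.
Qed.

Variable (G : ref_surface R).

Lemma surf_frameP (j : 'I_(ntri G)) d Y F x : represents3 j d Y F -> refT x ->
  enorm (jac Y j (chart j x)) != 0 ->
  exists a b : R * R, surf_frame Y j (chart j x) = (tangent j a, tangent j b) /\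
    orthonormal_pair (a.1 *: grad_dx F x +
      a.2 *: grad_dy F x) (b.1 *: grad_dx F x + b.2 *: grad_dy F x).
Proof.
move=> YF Tx J0.
have c0 : enorm (cross (grad_dx F x) (grad_dy F x)) != 0.
  apply: contra J0 => /eqP c0;
    rewrite (jac_represents3 YF Tx) enormZ c0 mulr0//.
have [a [b [ab1 ab2 ab3]]] := orthonormal_combination c0.
rewrite /surf_frame; set S := [set v | _].
have : S (xget (0, 0) S).
  apply: xgetPex; exists (tangent j a, tangent j b).
  split=> /=; rewrite ?(dtan_represents3 _ YF Tx)//.
  by split; apply/tangent_toP; eexists.
case: (xget _ _) => v1 v2 [/= [/tangent_toP[a' ->] /tangent_toP[b' ->]]].
rewrite !(dtan_represents3 _ YF Tx) => *.
by exists a', b'.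
Qed.

(** In an orthonormal frame the Frobenius product of two surface gradients is
    the sum of the products of the directional derivatives, and the gradient
    of the identity is the frame itself; this reduces the claim to
    [area_increment]. *)
Lemma energy_pointwise (j : 'I_(ntri G)) d Y Z F F' x (s : R) : 0 < s ->
  represents3 j d Y F -> represents3 j d Z F' -> refT x ->
  enorm (jac Y j (chart j x)) != 0 ->
  s * (enorm (jac_param (Z \o chart j) x) - enorm (jac_param (Y \o chart j)
    x)) <=
  mxdot (surf_grad3 Y Z j (chart j x))
        (surf_grad3 Y (fun z => s *: (Z z - Y z)) j (chart j x)) *
  enorm (jac_param (Y \o chart j) x).
Proof.
move=> s0 YF ZF Tx J0.
have [a [b [fE on]]] := surf_frameP YF Tx J0.
have EF : represents3 j d (fun z => s *: (Z z - Y z))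
    (fun k x => s * F' k x + (- s) * F k x).
  have -> : (fun z => s *: (Z z - Y z)) = (fun z => s *: Z z + (- s) *: Y z).
    by apply/funext => z; rewrite scalerBr scaleNr.
  exact: represents3_comb.
have pF k : polyfun d (F k) by case: (YF k).
have pF' k : polyfun d (F' k) by case: (ZF k).
rewrite /surf_grad3 fE /= !(dtan_represents3 _ YF Tx) !(dtan_represents3 _ ZF
  Tx).
rewrite !(dtan_represents3 _ EF Tx) !(grad_dx_comb _ _ _ pF' pF)
  !(grad_dy_comb _ _ _ pF' pF).
rewrite (jac_param_represents3 YF Tx) (jac_param_represents3 ZF Tx).
have := area_increment (grad_dx F' x) (grad_dy F' x) on.
move: on => [on1 on2 on3].
set t1 := a.1 *: grad_dx F x + _; set t2 := b.1 *: grad_dx F x + _.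
set z1 := a.1 *: grad_dx F' x + _; set z2 := b.1 *: grad_dx F' x + _ => h.
have -> : a.1 *: (s *: grad_dx F' x + - s *: grad_dx F x) +
  a.2 *: (s *: grad_dy F' x + - s *: grad_dy F x)
   = s *: (z1 - t1) by apply/rowP => k; rewrite !mxE; ring.
have -> : b.1 *: (s *: grad_dx F' x + - s *: grad_dx F x) +
  b.2 *: (s *: grad_dy F' x + - s *: grad_dy F x)
   = s *: (z2 - t2) by apply/rowP => k; rewrite !mxE; ring.
rewrite !mxdotDr ![mxdot (_ + _) _]mxdotC !mxdotDr !mxdot_tensor.
rewrite on1 on2 on3 [mxdot t2 t1]mxdotC on3 !mulr0 !mulr1 addr0 add0r.
rewrite ![mxdot (s *: _) _]mxdotC !mxdotZr -mulrDr -mulrA ler_pM2l//.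
Qed.

Variables (Q : nat) (xi : 'I_Q -> R * R) (omega : 'I_Q -> R).
Hypothesis xi_refT : forall i, refT (xi i).
Hypothesis omega_gt0 : forall i, 0 < omega i.

Lemma quad_prodC m n Y (u v : 'I_(ntri G) -> 'rV[R]_3 -> 'M[R]_(m, n)) :
  quad_prod xi omega mxdot Y u v = quad_prod xi omega mxdot Y v u.
Proof.
by apply: eq_bigr => j _; apply: eq_bigr => i _; rewrite mxdotC.
Qed.

(** Testing with phi = H and eta = (Z - Y) / tau makes the two terms with the
    averaged normal equal, so the Dirichlet term of H is minus the product of
    the gradients of Z and eta; the latter dominates the increment of the area
    at every node, and the weights are positive. *)
Lemma energy_step ell tau Y Z H : 0 < tau -> fe_space3 G ell Y ->
  (forall (j : 'I_(ntri G)) i, 0 < enorm (jac Y j (chart j (xi i)))) ->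
  scheme_step G ell xi omega tau Y Z H ->
  num_area G xi omega Z + tau *
    @quad_prod R G Q xi omega _ mxdot Y (surf_grad Y H) (surf_grad Y H)
  <= num_area G xi omega Y.
Proof.
move=> tau0 hY J0 [hZ hH eqX eqH].
set D := quad_prod _ _ _ _ (surf_grad Y H) _.
have heta : fe_space3 G ell (fun z => tau^-1 *: (Z z - Y z)).
  have -> : (fun z => tau^-1 *: (Z z - Y z)) =
      (fun z => tau^-1 *: Z z + (- tau^-1) *: Y z).
    by apply/funext => z; rewrite scalerBr scaleNr.
  exact: fe_space3_comb.
have {eqX} := eqX _ hH; have {eqH} := eqH _ heta.
rewrite quad_prodC -/D => eqH eqX.
set E := quad_prod _ _ _ _ (surf_grad3 Y Z) _ in eqH.
suff LE : tau^-1 * (num_area G xi omega Z - num_area G xi omega Y) <= E.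
  have DE : D = - E by apply/eqP; rewrite -addr_eq0 -(subr0_eq eqX) eqH.
  move: LE; rewrite -(ler_pM2l tau0) mulVKf ?gt_eqF// DE mulrN => LE.
  by rewrite lerBlDr -lerBlDl.
rewrite /E /num_area /quad_prod -sumrB mulr_sumr; apply: ler_sum => j _.
rewrite -sumrB mulr_sumr; apply: ler_sum => i _.
have [F YF] := fe_space3_represents j hY.
have [F' ZF] := fe_space3_represents j hZ.
have s0 : 0 < tau^-1 by rewrite invr_gt0.
have J0' : enorm (jac Y j (chart j (xi i))) != 0 by rewrite gt_eqF.
have h := energy_pointwise s0 YF ZF (xi_refT i) J0'.
have weigh (p q c w : R) : tau^-1 * (p - q) <= c * q -> 0 < w ->
    tau^-1 * (1 * 1 * p * w - 1 * 1 * q * w) <= c * q * w.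
  by move=> pq w0; rewrite !mul1r -mulrBl mulrA ler_pM2r.
exact: weigh h (omega_gt0 i).
Qed.

End energy.

(** * Cancellation over the edges of a closed surface *)
Section line_integral.
Context {R : realType} (G : ref_surface R).
Let mu := @lebesgue_measure R.

Lemma ord3_ind (P : 'I_3 -> Prop) : P 0 -> P 1 -> P 2 -> forall a, P a.
Proof.
move=> P0 P1 P2 [[|[|[|//]]] i3].
- by rewrite (_ : Ordinal i3 = 0)//; exact/val_inj.
- by rewrite (_ : Ordinal i3 = 1)//; exact/val_inj.
- by rewrite (_ : Ordinal i3 = 2)//; exact/val_inj.
Qed.

Lemma chart_ref_vertex (j : 'I_(ntri G)) a : chart j (ref_vertex a) = vtx j a.
Proof.
rewrite /chart /affmap.
by elim/ord3_ind: a; apply: row3P; rewrite /ref_vertex !mxE/=; ring.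
Qed.

Lemma vtx_inj (j : 'I_(ntri G)) : injective (vtx j).
Proof.
move=> a b; rewrite -!chart_ref_vertex => /affmap_inj[/eqP + /eqP].
rewrite !eqr_nat; elim/ord3_ind: a; elim/ord3_ind: b => //.
Qed.

(** The integral of the 1-form u dw along the segment from [p] to [q].  It is
    defined from the restrictions of [u] and [w] to the segment alone, so that
    the two triangles at an edge assign the same value to it: this is where
    the functions have to be single-valued on the surface.  The interval is
    open since the derivative at its end points would depend on values off the
    segment. *)
Definition line_integral (u w : 'rV[R]_3 -> R) (p q : 'rV[R]_3) : R :=
  \int[mu]_(t in `]0, 1[) (u (t *: (q - p) + p) *
    derive1 (fun s : R => w (s *: (q - p) + p)) t).

Lemma chart_segment (j : 'I_(ntri G)) a b (t : R) :
  chart j (segment a b t) = t *: (vtx j b - vtx j a) + vtx j a.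
Proof.
rewrite /segment chartE chart_ref_vertex; congr (_ *: _ + _).
have := chartE j (ref_vertex b - ref_vertex a) (ref_vertex a) 1.
rewrite !scale1r subrK !chart_ref_vertex => ->; by rewrite addrK.
Qed.

Lemma edge_line_integral (j : 'I_(ntri G)) d e u w U W a b :
  represents j d u U -> represents j e w W ->
  line_integral u w (vtx j a) (vtx j b) = edge_integral U W a b.
Proof.
move=> [pU uU] [pW wW].
have c := @edge_integrand_continuous _ _ _ _ _ a b pU pW.
have int01 (A : set R) : measurable A -> A `<=` `[0, 1] ->
    mu.-integrable A (EFin \o (fun t =>
      U (segment a b t) * segment_derive a b W t)).
  move=> mA A01; apply: (@integrableS _ _ _ mu `[0, 1]) => //.
  exact: integrable01.
rewrite /edge_integral -Rintegral_itv_obnd_cbnd; last first.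
  by apply: int01 => // t /=; rewrite !in_itv/= => ?; lra.
rewrite -Rintegral_itv_bndo_bndc; last first.
  by apply: int01 => // t /=; rewrite !in_itv/= => ?; lra.
apply: eq_Rintegral => t; rewrite inE/= in_itv/= => /andP[t0 t1].
rewrite -chart_segment uU; last by apply: segment_refT; rewrite !ltW.
congr (_ * _); rewrite derive1E.
rewrite (@near_eq_derive _ _ _ _ (fun s => W (segment a b s))).
  by have [] := is_derive_segment a b t pW.
near=> s; rewrite -chart_segment wW//; apply: segment_refT; apply/andP; split;
  apply: ltW; near: s.
- exact: lt_nbhsr.
- exact: lt_nbhsl.
Unshelve. all: by end_near. Qed.

Lemma line_integral_rev (j : 'I_(ntri G)) d e u w U W a b :
  represents j d u U -> represents j e w W ->
  line_integral u w (vtx j b) (vtx j a) =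
    - line_integral u w (vtx j a) (vtx j b).
Proof.
move=> hu hw; rewrite !(edge_line_integral _ _ hu hw).
exact: edge_integral_rev hu.1 hw.1.
Qed.

End line_integral.

Section closed_surface.
Context {R : realType} (G : ref_surface R).

(** The edge opposite to vertex [x.2 + 2] of triangle [x.1], directed so that
    the triangle lies on its positive side. *)
Definition oriented_edge (x : 'I_(ntri G) * 'I_3) : 'rV[R]_3 * 'rV[R]_3 :=
  let p := vtx x.1 x.2 in let q := vtx x.1 (x.2 + 1) in
  if 0 < orient x.1 then (p, q) else (q, p).

Lemma orient_cases (j : 'I_(ntri G)) : orient j = 1 \/ orient j = -1.
Proof.
by have /eqP := orient_sqr j; rewrite sqrf_eq1 => /orP[] /eqP ->; [left|right].
Qed.

Lemma orient_area (j : 'I_(ntri G)) :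
  mxdot (facet_normal j) (frame_normal j) = orient j * area j.
Proof. by rewrite /orient divfK ?gt_eqF ?area_gt0// mxdotC. Qed.

Lemma cross_sides (j : 'I_(ntri G)) a :
  cross (vtx j (a + 1) - vtx j a) (vtx j (a + 2) - vtx j a) = facet_normal j.
Proof.
rewrite /facet_normal /side1 /side2.
by elim/ord3_ind: a; rewrite ?add0r ?ord3E; apply: row3P;
  rewrite !mxE ?ord3E ?add0r; ring.
Qed.

Lemma oriented_edge_positive x :
  positive_edge (vtx x.1) (frame_normal x.1)
    (oriented_edge x).1 (oriented_edge x).2.
Proof.
case: x => j a; rewrite /oriented_edge /=.
have := area_gt0 j; have := cross_sides j a; have := orient_area j.
case: (orient_cases j) => -> o c A.
  rewrite ltr01; exists a, (a + 1), (a + 2); split=> //.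
  by rewrite c o mul1r.
rewrite ltr0N1; exists (a + 1), a, (a + 2); split=> //.
have -> : cross (vtx j a - vtx j (a + 1)) (vtx j (a + 2) - vtx j (a + 1)) =
    (-1) *: facet_normal j.
  by rewrite -c; apply: row3P; rewrite !mxE ?ord3E ?add0r; ring.
by rewrite mxdotC mxdotZr mxdotC o !mulN1r opprK.
Qed.

(** Two triangles never traverse an edge in the same direction. *)
Lemma oriented_edge_inj : injective oriented_edge.
Proof.
move=> x y xy; have := oriented_edge_positive x;
  have := oriented_edge_positive y.
rewrite -xy => py px.
have jk : x.1 = y.1.
  apply/eqP; apply: contraT => /coherent xy1.
  by case: (xy1 _ _ px py).
case: x y xy jk {px py} => j a [k b] /= + jk; rewrite -{}jk /oriented_edge /=.
by case: ifP => _ []; [move=> /vtx_inj ->|move=> _ /vtx_inj ->].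
Qed.

Lemma ord3_neq (a b : 'I_3) : a != b -> b = a + 1 \/ a = b + 1.
Proof.
elim/ord3_ind: a; elim/ord3_ind: b => //= _;
 by [left; exact/val_inj|right; exact/val_inj].
Qed.

(** The second triangle at the edge traverses it in one of the two directions,
    and by injectivity not in the same one. *)
Lemma oriented_edge_swap x : exists y,
  oriented_edge y = ((oriented_edge x).2, (oriented_edge x).1).
Proof.
case: x => j a.
have aa : a != a + 1 by elim/ord3_ind: a.
have := closed_edges j aa; set K := [set k | _]%SET => K2.
have jK : j \in K by rewrite inE !codom_f.
have : (0 < #|K :\ j|)%N.
  by move: K2; rewrite (cardsD1 j) jK add1n => -[->].
case/card_gt0P => k; rewrite !inE => /and3P[kj /codomP[b Eb] /codomP[c Ec]].
have bc : b != c.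
  by apply: contra aa => /eqP bc; apply/eqP/(@vtx_inj _ _ j); rewrite Eb Ec bc.
have main y : y.1 = k ->
    oriented_edge y = oriented_edge (j, a) \/
    oriented_edge y = ((oriented_edge (j, a)).2, (oriented_edge (j, a)).1) ->
    exists y, oriented_edge y = ((oriented_edge (j, a)).2, (oriented_edge (j,
      a)).1).
  move=> yk [/oriented_edge_inj yj|E]; last by exists y.
  by move: kj; rewrite -yk yj eqxx.
case: (ord3_neq bc) => E; [apply: (main (k, b))|apply: (main (k, c))] => //;
  rewrite /oriented_edge/= Eb Ec E; case: ifP => _; case: ifP => _ /=;
  by [left|right].
Qed.

(** Sending an oriented edge to its reversal, seen from the neighbouring
    triangle, is a permutation of the edges under which the sum changes its
    sign. *)
Lemma closed_surface_sum (I : 'rV[R]_3 -> 'rV[R]_3 -> R) :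
  (forall (j : 'I_(ntri G)) a b, I (vtx j b) (vtx j a) =
    - I (vtx j a) (vtx j b)) ->
  \sum_(j < ntri G) orient j * (\sum_(a < 3) I (vtx j a) (vtx j (a + 1))) = 0.
Proof.
move=> antiI.
have E j a : orient j * I (vtx j a) (vtx j (a + 1)) =
    I (oriented_edge (j, a)).1 (oriented_edge (j, a)).2.
  rewrite /oriented_edge/=; case: (orient_cases j) => ->.
    by rewrite ltr01 mul1r.
  by rewrite ltr0N1 mulN1r -antiI.
under eq_bigr do rewrite mulr_sumr.
rewrite (eq_bigr (fun j => \sum_(a < 3)
    I (oriented_edge (j, a)).1 (oriented_edge (j, a)).2)); last first.
  by move=> j _; apply: eq_bigr => a _; exact: E.
rewrite pair_bigA/=; set S := (X in X = 0).
have /choice[h hE] := oriented_edge_swap.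
have h_inj : injective h.
  move=> x y xy; apply: oriented_edge_inj.
  have := hE x; rewrite xy hE => -[]; case: (oriented_edge x) => ? ?.
  by case: (oriented_edge y) => ? ? /= -> ->.
have SN : S = - S.
  rewrite {1}/S (reindex_inj h_inj)/= -sumrN; apply: eq_bigr => -[j a] _ /=.
  rewrite -!surjective_pairing hE /= -E /oriented_edge/=.
  case: (orient_cases j) => ->; first by rewrite ltr01 mul1r -antiI.
  by rewrite ltr0N1 mulN1r opprK.
by lra.
Qed.

End closed_surface.

(** * The alternating volume form *)
Section alternating_form.
Context {R : realType} (G : ref_surface R).
Implicit Types f g h : 'rV[R]_3 -> R.

(** The integral of the 2-form f dg /\ dh over the oriented surface. *)
Definition triform f g h : R :=
  \sum_(j < ntri G) orient j * int_refT (fun x =>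
    f (chart j x) *
    (dwithin refT_open ((1, 0) : R * R) (g \o chart j) x *
     dwithin refT_open ((0, 1) : R * R) (h \o chart j) x -
     dwithin refT_open ((0, 1) : R * R) (g \o chart j) x *
     dwithin refT_open ((1, 0) : R * R) (h \o chart j) x)).

Lemma dwithin_represents (j : 'I_(ntri G)) d f F w x :
  represents j d f F -> refT x ->
  dwithin refT_open w (f \o chart j) x = w.1 * dx F x + w.2 * dy F x.
Proof.
move=> [pF fF] Tx; apply: (dwithin_refT fF _ _ Tx (DF := fun x => _)).
  by move=> y; exact: is_derive_polyfun pF.
exact: (@polyfun_dir_continuous R d F w pF x).
Qed.

Lemma triformE d f g h (F H K : 'I_(ntri G) -> R * R -> R) :
  (forall j, represents j d f (F j)) -> (forall j, represents j d g (H j)) ->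
  (forall j, represents j d h (K j)) ->
  triform f g h =
  \sum_(j < ntri G) orient j * int_refT (fun x =>
    F j x * bracket (H j) (K j) x).
Proof.
move=> fF gH hK; apply: eq_bigr => j _; congr (_ * _);
  apply: eq_int_refT => x Tx.
rewrite !(dwithin_represents _ (gH j) Tx) !(dwithin_represents _ (hK j) Tx).
by rewrite (fF j).2// /bracket /= !mul1r !mul0r !add0r !addr0.
Qed.

Lemma fe_space_represents_all d f : fe_space G d f ->
  exists F : 'I_(ntri G) -> R * R -> R, forall j, represents j d f (F j).
Proof.
move=> hf; have /choice[F fF] j := fe_space_represents j hf.
by exists F.
Qed.

Lemma fe_space3_represents_all d Y : fe_space3 G d Y ->
  exists F : 'I_(ntri G) -> 'I_3 -> R * R ->
    R, forall j, represents3 j d Y (F j).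
Proof.
move=> hY; have /choice[F YF] j := fe_space3_represents j hY.
by exists F.
Qed.

Lemma triform_linear d a b f f' g h : fe_space G d f -> fe_space G d f' ->
  fe_space G d g -> fe_space G d h ->
  triform (fun z => a * f z + b * f' z) g h =
  a * triform f g h + b * triform f' g h.
Proof.
move=> /fe_space_represents_all[F fF] /fe_space_represents_all[F' fF'].
move=> /fe_space_represents_all[H gH] /fe_space_represents_all[K hK].
rewrite (triformE (fun j => represents_comb a b (fF j) (fF' j)) gH hK).
rewrite (triformE fF gH hK) (triformE fF' gH hK) !mulr_sumr -big_split/=.
apply: eq_bigr => j _.
have pB := polyfun_bracket (gH j).1 (hK j).1.
have p := polyfunM (fF j).1 pB; have p' := polyfunM (fF' j).1 pB.
have -> : (fun x => (a * F j x + b * F' j x) * bracket (H j) (K j) x) =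
   (fun x => a * (F j x * bracket (H j) (K j) x) +
     b * (F' j x * bracket (H j) (K j) x)).
  by apply/funext => x; ring.
rewrite (int_refTD (polyfunZ a p) (polyfunZ b p')) (int_refTZ a p) (int_refTZ
  b p').
by ring.
Qed.

Lemma triform_swap23 d f g h : fe_space G d f ->
  fe_space G d g -> fe_space G d h -> triform f h g = - triform f g h.
Proof.
move=> /fe_space_represents_all[F fF].
move=> /fe_space_represents_all[H gH] /fe_space_represents_all[K hK].
rewrite (triformE fF gH hK) (triformE fF hK gH) -sumrN; apply: eq_bigr => j _.
have p := polyfunM (fF j).1 (polyfun_bracket (gH j).1 (hK j).1).
rewrite -mulrN; congr (_ * _); rewrite -mulN1r -(int_refTZ _ p).
by apply: eq_int_refT => x _; rewrite /bracket; ring.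
Qed.

(** The sum of both sides is the integral of f dg /\ dh + g df /\ dh = d(fg
    dh), which is exact: by Green's formula it becomes a sum of line integrals
    over the edges, and these cancel on a closed surface. *)
Lemma triform_swap12 d f g h : fe_space G d f ->
  fe_space G d g -> fe_space G d h -> triform g f h = - triform f g h.
Proof.
move=> /fe_space_represents_all[F fF].
move=> /fe_space_represents_all[H gH] /fe_space_represents_all[K hK].
rewrite (triformE fF gH hK) (triformE gH fF hK).
apply/eqP; rewrite -addr_eq0 -big_split/=; apply/eqP.
pose FH j x := F j x * H j x.
have fgFH j : represents j (d + d) (fun z => f z * g z) (FH j).
  split; first exact: polyfunM (fF j).1 (gH j).1.
  by move=> x Tx; rewrite /FH -(fF j).2// -(gH j).2.
rewrite -[RHS](@closed_surface_sum _ G (line_integral (fun z =>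
  f z * g z) h)); last first.
  by move=> j a b; exact: line_integral_rev (fgFH j) (hK j).
apply: eq_bigr => j _; rewrite -mulrDr; congr (_ * _).
have p := polyfunM (fF j).1 (polyfun_bracket (gH j).1 (hK j).1).
have p' := polyfunM (gH j).1 (polyfun_bracket (fF j).1 (hK j).1).
rewrite -(int_refTD p' p).
under [RHS]eq_bigr do rewrite (edge_line_integral _ _ (fgFH j) (hK j)).
rewrite -(green_refT (fgFH j).1 (hK j).1); apply: eq_int_refT => x _.
by rewrite (bracketM _ _ (fF j).1 (gH j).1) addrC.
Qed.

End alternating_form.

(** * Simpson's rule for alternating forms *)

(** The setting is abstract in order that the proof only sees the form as a
    trilinear alternating function on a linear space [P] of functions. *)
Section simpson.
Context {R : realType} {X : Type} (P : (X -> R) -> Prop)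
  (B : (X -> R) -> (X -> R) -> (X -> R) -> R).
Hypothesis P_comb : forall a b f g, P f -> P g ->
  P (fun z => a * f z + b * g z).
Hypothesis B_linear : forall a b f f' g h, P f -> P f' -> P g -> P h ->
  B (fun z => a * f z + b * f' z) g h = a * B f g h + b * B f' g h.
Hypothesis B_swap12 : forall f g h, P f -> P g -> P h -> B g f h = - B f g h.
Hypothesis B_swap23 : forall f g h, P f -> P g -> P h -> B f h g = - B f g h.

Definition cyclic_sum (f g : 'I_3 -> X -> R) : R :=
  B (f 0) (g 1) (g 2) + B (f 1) (g 2) (g 0) + B (f 2) (g 0) (g 1).

Let B_cycle f g h : P f -> P g -> P h -> B f g h = B h f g.
Proof. by move=> pf pg ph; rewrite (B_swap12 pf ph pg) (B_swap23 pf pg ph)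
  opprK. Qed.

Lemma cyclic_sum_diag f : (forall k, P (f k)) ->
  cyclic_sum f f = 3 * B (f 0) (f 1) (f 2).
Proof.
move=> pf; rewrite /cyclic_sum (B_cycle (pf 1) (pf 2) (pf 0)).
by rewrite (B_cycle (pf 2) (pf 0) (pf 1)) (B_cycle (pf 1) (pf 2) (pf 0)); ring.
Qed.

(** The cubic polynomial t -> B((1-t) y + t z) has derivative cyclic_sum (z -
    y) ((1-t) y + t z), which is quadratic in t, and Simpson's rule with nodes
    0, 1/2, 1 integrates it exactly.  The proof expands everything into the
    eight values of [B] at arguments chosen among y and z. *)
Lemma simpson_alternating (s : R) (y z : 'I_3 -> X -> R) :
  (forall k, P (y k)) -> (forall k, P (z k)) ->
  let d k := fun x => s * z k x + - s * y k x in
  let m k := fun x => 2^-1 * y k x + 2^-1 * z k x in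
  cyclic_sum d y + 4 * cyclic_sum d m + cyclic_sum d z =
  6 * s * (B (z 0) (z 1) (z 2) - B (y 0) (y 1) (y 2)).
Proof.
move=> py pz /=.
pose f (b : bool) := if b then z else y.
have pf b k : P (f b k) by case: b.
have l2 a b u v v' w : P u -> P v -> P v' -> P w ->
    B u (fun x => a * v x + b * v' x) w = a * B u v w + b * B u v' w.
  move=> pu pv pv' pw; rewrite -(opprK (B u _ w)) -B_swap12 ?B_linear//;
    last exact: P_comb.
  by rewrite (B_swap12 pu pv pw) (B_swap12 pu pv' pw); ring.
have l3 a b u v w w' : P u -> P v -> P w -> P w' ->
    B u v (fun x => a * w x + b * w' x) = a * B u v w + b * B u v w'.
  move=> pu pv pw pw'; have pc := P_comb a b pw pw'.
  rewrite (B_swap23 pu pc pv) l2// (B_swap23 pu pv pw) (B_swap23 pu pv pw');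
    ring.
rewrite /cyclic_sum.
rewrite !(B_linear, l2, l3) //; do ?exact: P_comb.
pose T a b c := B (f a 0) (f b 1) (f c 2).
have c1 a b c : B (f a 1) (f b 2) (f c 0) = T c a b by rewrite B_cycle.
have c2 a b c : B (f a 2) (f b 0) (f c 1) =
  T b c a by rewrite B_cycle// B_cycle.
have := (c1 true true true, c1 true true false, c1 true false true,
  c1 true false false).
have := (c1 false true true, c1 false true false, c1 false false true,
  c1 false false false).
have := (c2 true true true, c2 true true false, c2 true false true,
  c2 true false false).
have := (c2 false true true, c2 false true false, c2 false false true,
  c2 false false false).
rewrite /T /f => E1 E2 E3 E4; rewrite !(E1, E2, E3, E4).
by field.
Qed.

End simpson.

(** * Conservation of the volume *)
Section flux.
Context {R : realType}.

(** The integrand F . (d_x H x d_y H) of the first variation of the volume. *)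
Definition flux_density (F H : 'I_3 -> R * R -> R) (x : R * R) : R :=
  mxdot (\row_k F k x) (cross (grad_dx H x) (grad_dy H x)).

Lemma flux_densityE F H : flux_density F H = (fun x =>
  F 0 x * bracket (H 1) (H 2) x + F 1 x * bracket (H 2) (H 0) x +
  F 2 x * bracket (H 0) (H 1) x).
Proof.
by apply/funext => x; rewrite /flux_density !vecE !mxE /bracket; ring.
Qed.

Lemma polyfun_flux_density d F H : (forall k, polyfun d (F k)) ->
  (forall k, polyfun d (H k)) ->
  polyfun (d + (d.-1 + d.-1)) (flux_density F H).
Proof.
move=> pF pH; rewrite flux_densityE.
have p a b c := polyfunM (pF a) (polyfun_bracket (pH b) (pH c)).
exact: (polyfunD (polyfunD (p _ _ _) (p _ _ _)) (p _ _ _)).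
Qed.

Lemma int_flux_density d F H : (forall k, polyfun d (F k)) ->
  (forall k, polyfun d (H k)) ->
  int_refT (flux_density F H) =
  int_refT (fun x => F 0 x * bracket (H 1) (H 2) x) +
  int_refT (fun x => F 1 x * bracket (H 2) (H 0) x) +
  int_refT (fun x => F 2 x * bracket (H 0) (H 1) x).
Proof.
move=> pF pH; rewrite flux_densityE.
have p a b c := polyfunM (pF a) (polyfun_bracket (pH b) (pH c)).
by rewrite (int_refTD (polyfunD (p 0 1 2) (p 1 2 0)) (p 2 0 1))
  (int_refTD (p 0 1 2) (p 1 2 0)).
Qed.

Variable G : ref_surface R.

Lemma flux_triform d D Y (F H : 'I_(ntri G) -> 'I_3 -> R * R -> R) :
  (forall j, represents3 j d D (F j)) -> (forall j, represents3 j d Y (H j)) ->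
  \sum_(j < ntri G) orient j * int_refT (flux_density (F j) (H j)) =
  cyclic_sum (@triform R G) (fun k z => D z 0 k) (fun k z => Y z 0 k).
Proof.
move=> DF YH; rewrite /cyclic_sum.
rewrite (triformE (fun j => DF j 0) (fun j => YH j 1) (fun j => YH j 2)).
rewrite (triformE (fun j => DF j 1) (fun j => YH j 2) (fun j => YH j 0)).
rewrite (triformE (fun j => DF j 2) (fun j => YH j 0) (fun j => YH j 1)).
rewrite -!big_split/=; apply: eq_bigr => j _.
by rewrite (int_flux_density (fun k => (DF j k).1) (fun k =>
  (YH j k).1)) !mulrDr.
Qed.

(** The three terms of Y . J(Y) contribute equally because the form is
    invariant under cyclic permutations, which absorbs the factor 1/3. *)
Lemma volume_triform d Y : fe_space3 G d Y ->
  volume G Y = triform G (fun z => Y z 0 0) (fun z => Y z 0 1) (fun z =>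
    Y z 0 2).
Proof.
move=> hY; have [F YF] := fe_space3_represents_all hY.
have -> : volume G Y = 3^-1 *
    \sum_(j < ntri G) orient j * int_refT (flux_density (F j) (F j)).
  rewrite /volume /surf_int; congr (_ * _); apply: eq_bigr => j _.
  have pF k := (YF j k).1.
  rewrite -(int_refTZ _ (polyfun_flux_density pF pF));
    apply: eq_int_refT => x Tx.
  rewrite (jac_represents3 (YF j) Tx) (represents3_row (YF j) Tx) mxdotZr.
  rewrite -/(side1 j) -/(side2 j) -/(facet_normal j) -/(area j).
  by rewrite mulrAC divfK ?gt_eqF ?area_gt0.
rewrite (flux_triform YF YF).
rewrite (@cyclic_sum_diag _ _ (fe_space G d)) ?mulKf//.
- by move=> *; exact: (triform_swap12 (d := d)).
- by move=> *; exact: (triform_swap23 (d := d)).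
Qed.

Lemma surf_grad_cst (j : 'I_(ntri G)) Y (c : R) (x : R * R) : refT x ->
  surf_grad Y (fun=> c) j (chart j x) = 0.
Proof.
move=> Tx.
have d v : dtan j v (fun=> c) (chart j x) = 0.
  apply: (@dwithin_eq _ _ _ _ _ _ (fun=> 0)); last exact: closure_chart.
    by move=> y _; exact: derive_cst.
  exact: cst_continuous.
(* for real variables: comparing the one-sided derivatives themselves with
   each other would unfold limits *)
have comb0 (a b : R) (s t : 'rV[R]_3) : a = 0 -> b = 0 -> a *: s + b *: t = 0.
  by move=> -> ->; rewrite !scale0r addr0.
exact: comb0 (d _) (d _).
Qed.

Variables (Q : nat) (xi : 'I_Q -> R * R) (omega : 'I_Q -> R).
Hypothesis xi_refT : forall i, refT (xi i).

(** The test function phi = 1 leaves the quadrature of the velocity times the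
    Simpson average of the Jacobians.  Its integrand is a polynomial of degree
    ell + 2 (ell - 1) = 3 ell - 2, so quadrature is exact and
    [simpson_alternating] identifies the integral with a multiple of the
    change of volume. *)
Lemma volume_step ell tau Y Z H : 0 < tau -> (1 <= ell)%N ->
  exact_to_degree (3 * ell - 2)%N xi omega -> fe_space3 G ell Y ->
  (forall (j : 'I_(ntri G)) i, 0 < enorm (jac Y j (chart j (xi i)))) ->
  scheme_step G ell xi omega tau Y Z H ->
  volume G Z = volume G Y.
Proof.
move=> tau0 ell1 xi_exact hY J0 [hZ _ eqX _].
have [FY YF] := fe_space3_represents_all hY.
have [FZ ZF] := fe_space3_represents_all hZ.
pose M := midpoint_map Y Z; pose D z := tau^-1 *: (Z z - Y z).
pose FM j k x := 2^-1 * FY j k x + 2^-1 * FZ j k x.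
pose FD j k x := tau^-1 * FZ j k x + - tau^-1 * FY j k x.
have MF j : represents3 j ell M (FM j).
  rewrite (_ : M = fun z => 2^-1 *: Y z + 2^-1 *: Z z);
    first exact: represents3_comb.
  by apply/funext => z; rewrite /M /midpoint_map scalerDr.
have DF j : represents3 j ell D (FD j).
  rewrite (_ : D = fun z => tau^-1 *: Z z + - tau^-1 *: Y z);
    first exact: represents3_comb.
  by apply/funext => z; rewrite /D scalerBr scaleNr.
have pY j k := (YF j k).1; have pZ j k := (ZF j k).1.
have pM j k := (MF j k).1; have pD j k := (DF j k).1.
pose g j x := flux_density (FD j) (FY j) x + 4 * flux_density (FD j) (FM j) x +
  flux_density (FD j) (FZ j) x.
have p1 j := polyfun_flux_density (pD j) (pY j).
have p2 j := polyfun_flux_density (pD j) (pM j).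
have p3 j := polyfun_flux_density (pD j) (pZ j).
have pg j : polyfun (3 * ell - 2) (g j).
  apply: (@polyfunW _ (ell + (ell.-1 + ell.-1))); first lia.
  exact: polyfunD (polyfunD (p1 j) (polyfunZ 4 (p2 j))) (p3 j).
have tested : \sum_(j < ntri G) orient j * int_refT (g j) = 0.
  have := eqX _ (fe_space_cst _ _ 1).
  have -> : @quad_prod R G Q xi omega _ mxdot Y (surf_grad Y H)
      (surf_grad Y (fun=> 1)) = 0.
    apply: big1 => j _; apply: big1 => i _.
    rewrite surf_grad_cst// -(scale0r (0 : 'rV[R]_3)) mxdotZr !mul0r//.
  rewrite subr0 => E; apply: (mulfI (x := 6^-1)); first by rewrite invr_eq0.
  rewrite mulr0 -[RHS]E mulr_sumr; apply: eq_bigr => j _.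
  rewrite -(xi_exact _ (polyfun_poly_refT (pg j))) !mulr_sumr;
    apply: eq_bigr => i _.
  have Tx := xi_refT i; set z := chart j (xi i).
  have e0 := J0 j i.
  set k := orient j / area j.
  (* the averaged normal, as a function of the length of the Jacobian *)
  pose n e : 'rV[R]_3 := (6 * e)^-1 *:
      (k *: cross (grad_dx (FY j) (xi i)) (grad_dy (FY j) (xi i)) +
       4 *: (k *: cross (grad_dx (FM j) (xi i)) (grad_dy (FM j) (xi i))) +
       k *: cross (grad_dx (FZ j) (xi i)) (grad_dy (FZ j) (xi i))).
  have hnE : half_normal Y Z j z = n (enorm (jac Y j z)).
    congr (_ *: (_ + 4 *: _ + _)).
    - exact: jac_represents3 (YF j) Tx.
    - exact: jac_represents3 (MF j) Tx.
    - exact: jac_represents3 (ZF j) Tx.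
  have DE : tau^-1 *: (Z z - Y z) = \row_k FD j k (xi i).
    exact: represents3_row (DF j) _ Tx.
  have EP := enorm_jac_param (YF j) Tx; rewrite -/z in EP.
  have eval e A B p : 0 < e -> A = \row_k FD j k (xi i) -> B = n e ->
      p = area j * e ->
      6^-1 * (orient j * (g j (xi i) * omega i)) =
      mxdot A (1 *: B) * p * omega i; last exact: eval e0 DE hnE EP.
  move=> {}e0 -> -> ->; rewrite /n !mxdotZr !mxdotDr !mxdotZr.
  rewrite -!/(flux_density _ _ _) /g /k.
  by field; rewrite !gt_eqF ?area_gt0.
have tested' : cyclic_sum (@triform R G) (fun k z => D z 0 k) (fun k z =>
  Y z 0 k)
  + 4 * cyclic_sum (@triform R G) (fun k z => D z 0 k) (fun k z => M z 0 k)
  + cyclic_sum (@triform R G) (fun k z => D z 0 k) (fun k z => Z z 0 k) = 0.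
  rewrite -(flux_triform DF YF) -(flux_triform DF MF) -(flux_triform DF ZF).
  rewrite -[RHS]tested mulr_sumr -!big_split/=; apply: eq_bigr => j _.
  rewrite (int_refTD (polyfunD (p1 j) (polyfunZ 4 (p2 j))) (p3 j)).
  rewrite (int_refTD (p1 j) (polyfunZ 4 (p2 j))) (int_refTZ 4 (p2 j)); ring.
have := @simpson_alternating _ _ (fe_space G ell) (@triform R G)
   (@fe_space_comb _ G ell) (@triform_linear _ G ell) (@triform_swap12 _ G ell)
   (@triform_swap23 _ G ell) tau^-1 (fun k z => Y z 0 k) (fun k z =>
     Z z 0 k) hY hZ.
rewrite (volume_triform hY) (volume_triform hZ) /=.
have DE : (fun k z => D z 0 k) =
    (fun (k : 'I_3) z => tau^-1 * Z z 0 k + - tau^-1 * Y z 0 k).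
  by apply/funext => k; apply/funext => z; rewrite /D !mxE mulrBr mulNr.
have ME : (fun k z => M z 0 k) =
    (fun (k : 'I_3) z => 2^-1 * Y z 0 k + 2^-1 * Z z 0 k).
  by apply/funext => k; apply/funext => z; rewrite /M !mxE mulrDr.
rewrite -DE -ME tested' => eq0.
have cancel6 (a b : R) : 0 = 6 * tau^-1 * (a - b) -> a = b.
  move=> /esym/eqP; rewrite mulf_eq0 subr_eq0 mulf_eq0 invr_eq0 pnatr_eq0/=.
  by rewrite gt_eqF//= => /eqP.
exact: cancel6 eq0.
Qed.

End flux.

Theorem theorem3p4 (R : realType) (G : ref_surface R) (tau : R) (M ell Q : nat)
    (xi : 'I_Q -> R * R) (omega : 'I_Q -> R)
    (Y : nat -> 'rV[R]_3 -> 'rV[R]_3) (H : nat -> 'rV[R]_3 -> R)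
    (tau_gt0 : 0 < tau)
    (ell_ge1 : (1 <= ell)%N)
    (xi_inj : injective xi)
    (xi_refT : forall i, refT (xi i))
    (omega_gt0 : forall i, 0 < omega i)
    (quad_exact : exact_to_degree (3 * ell - 2)%N xi omega)
    (Y0_fe : fe_space3 G ell (Y 0%N))
    (B1h : forall m, (m <= M)%N -> forall (j : 'I_(ntri G)) (i : 'I_Q),
      0 < enorm (jac (Y m) j (chart j (xi i))))
    (scheme : forall m, (m <= M)%N ->
      scheme_step G ell xi omega tau (Y m) (Y m.+1) (H m.+1)) :
  num_area G xi omega (Y M.+1)
    + tau * (\sum_(m < M.+1)
        @quad_prod R G Q xi omega _ mxdot (Y m)
          (surf_grad (Y m) (H m.+1)) (surf_grad (Y m) (H m.+1)))
    <= num_area G xi omega (Y 0%N)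
  /\ (forall m, (m <= M)%N -> volume G (Y m.+1) = volume G (Y m)).
Proof.
have Y_fe m : (m <= M)%N -> fe_space3 G ell (Y m).
  by case: m => // m mM; have [] := scheme m (ltnW mM).
split; last first.
  move=> m mM.
  exact: (volume_step xi_refT tau_gt0 ell_ge1 quad_exact (Y_fe m mM)
    (B1h m mM) (scheme m mM)).
pose S m := num_area G xi omega (Y m).
pose D m := @quad_prod R G Q xi omega _ mxdot (Y m)
  (surf_grad (Y m) (H m.+1)) (surf_grad (Y m) (H m.+1)).
have step m : (m <= M)%N -> S m.+1 + tau * D m <= S m.
  move=> mM; exact: (energy_step xi_refT omega_gt0 tau_gt0 (Y_fe m mM)
    (B1h m mM) (scheme m mM)).
suff telescope n : (n <= M.+1)%N -> S n + tau * (\sum_(m < n) D m) <= S 0%N.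
  exact: telescope.
move: (S) (D) step => {}S {}D step.
elim: n => [_|n IH nM]; first by rewrite big_ord0 mulr0 addr0.
have := IH (ltnW nM); have := step n nM.
by rewrite big_ord_recr/= mulrDr; lra.
Qed.
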